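(* Let $k$ be a perfect field of characteristic $p>0$. Suppose that $\sigma$ is an almost rational automorphism of $k[[t]]$ of order $p^n$ for some $n>1$. Then $p=2$, $n=2$, and there exists $b \in k$ (unique modulo $\wp(k) = \{\wp(a) : a \in k\}$) such that $\sigma$ is conjugate in $\operatorname{Aut}(k[[t]])$ to the order $4$ almost rational automorphism determined by $$\sigma_b(t) := \frac{b^2 t + (b+1)t^2 + \beta}{b^2+t^2},$$ where $\beta$ is the unique solution to $\beta^2-\beta=t^3+(b^2+b+1)t^2$ in $t k[[t]]$.
   Context: $\operatorname{Aut}(k[[t]])$ is the group of $k$-algebra automorphisms of the power series ring $k[[t]]$; such an automorphism is determined by the power series $\sigma(t)$, and it extends to $k((t))$. The Artin--Schreier operator is $\wp(x) := x^p - x$. An element $\sigma \in \operatorname{Aut}(k[[t]])$ of finite order, generating the finite group $G=\langle\sigma\rangle$, is called almost rational if the field $L := k(\{\tau(t): \tau \in G\}) \subseteq k((t))$ is a $\mathbb{Z}/p\mathbb{Z}$ Artin--Schreier extension of $k(t)$; i.e., $L=k(t,\beta)$ where $\beta \in k((t))$ satisfies $\wp(\beta)=\alpha$ for some $\alpha \in k(t)$. The fraction defining $\sigma_b(t)$ is computed in $k((t))$. *)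

(* Defs.v *)
From HB Require Import structures.
From mathcomp Require Import all_boot all_algebra.
From mathcomp Require Import boolp classical_sets.

Set Implicit Arguments.
Unset Strict Implicit.
Unset Printing Implicit Defensive.

Import GRing.Theory.

Local Open Scope ring_scope.
Local Open Scope classical_set_scope.

(* A wrapper around [nat -> R] is needed: the functions themselves carry the
   pointwise product. *)
Record fps (R : Type) := Fps { coefs :> nat -> R }.

Section PowerSeries.
Variable k : fieldType.
Implicit Types f g h : fps k.

HB.instance Definition _ := gen_eqMixin (fps k).
HB.instance Definition _ := gen_choiceMixin (fps k).

Lemma fpsP f g : (forall n, f n = g n) <-> f = g.
Proof.
split=> [|-> //]; case: f g => [u] [v] /= eq_uv.
by congr Fps; apply/funext.
Qed.

Definition fps_zero : fps k := Fps (fun _ => 0).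
Definition fps_opp f : fps k := Fps (fun n => - f n).
Definition fps_add f g : fps k := Fps (fun n => f n + g n).
Definition fps_one : fps k := Fps (fun n => (n == 0%N)%:R).
Definition fps_mul f g : fps k := Fps (fun n => \sum_(i < n.+1) f i * g (n - i)%N).
Definition fps_scale c f : fps k := Fps (fun n => c * f n).

Fact fps_addA : associative fps_add.
Proof. by move=> f g h; apply/fpsP => n /=; rewrite addrA. Qed.
Fact fps_addC : commutative fps_add.
Proof. by move=> f g; apply/fpsP => n /=; rewrite addrC. Qed.
Fact fps_add0 : left_id fps_zero fps_add.
Proof. by move=> f; apply/fpsP => n /=; rewrite add0r. Qed.
Fact fps_addN : left_inverse fps_zero fps_opp fps_add.
Proof. by move=> f; apply/fpsP => n /=; rewrite addNr. Qed.

HB.instance Definition _ :=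
  GRing.isZmodule.Build (fps k) fps_addA fps_addC fps_add0 fps_addN.

Definition fps_trunc N f : {poly k} := \poly_(i < N.+1) f i.

Lemma coef_fps_trunc N f n : (n <= N)%N -> (fps_trunc N f)`_n = f n.
Proof. by move=> le_nN; rewrite coef_poly ltnS le_nN. Qed.

Lemma coef_fps_mul N f g n : (n <= N)%N ->
  fps_mul f g n = (fps_trunc N f * fps_trunc N g)`_n.
Proof.
move=> le_nN; rewrite coefM; apply: eq_bigr => i _.
rewrite !coef_fps_trunc //; first exact: leq_trans (leq_subr _ _) le_nN.
by apply: leq_trans le_nN; rewrite -ltnS.
Qed.

Fact fps_mulC : commutative fps_mul.
Proof.
by move=> f g; apply/fpsP => n; rewrite !(coef_fps_mul _ _ (leqnn n)) mulrC.
Qed.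

Fact fps_mulA : associative fps_mul.
Proof.
have mulE f g h n : fps_mul (fps_mul f g) h n =
    (fps_trunc n f * fps_trunc n g * fps_trunc n h)`_n.
  rewrite coefM; apply: eq_bigr => i _.
  have le_in : (i <= n)%N by rewrite -ltnS.
  by rewrite (coef_fps_mul _ _ le_in) coef_fps_trunc // leq_subr.
move=> f g h; apply/fpsP => n.
by rewrite mulE fps_mulC mulE; congr (_`_n); rewrite mulrC mulrA.
Qed.

Fact fps_mul1 : left_id fps_one fps_mul.
Proof.
move=> f; apply/fpsP => n /=; rewrite big_ord_recl /= mul1r subn0.
by rewrite big1 ?addr0 // => i _; rewrite mul0r.
Qed.

Fact fps_mulDl : left_distributive fps_mul fps_add.
Proof.
move=> f g h; apply/fpsP => n /=; rewrite -big_split /=.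
by apply: eq_bigr => i _; rewrite mulrDl.
Qed.

Fact fps_one_neq0 : fps_one != 0.
Proof.
by apply/eqP => /fpsP/(_ 0%N)/eqP; rewrite /= oner_eq0.
Qed.

HB.instance Definition _ := GRing.Zmodule_isComNzRing.Build (fps k)
  fps_mulA fps_mulC fps_mul1 fps_mulDl fps_one_neq0.

Fact fps_scaleA a b f : fps_scale a (fps_scale b f) = fps_scale (a * b) f.
Proof. by apply/fpsP => n /=; rewrite mulrA. Qed.
Fact fps_scale1 : left_id 1 fps_scale.
Proof. by move=> f; apply/fpsP => n /=; rewrite mul1r. Qed.
Fact fps_scaleDr : right_distributive fps_scale +%R.
Proof. by move=> a f g; apply/fpsP => n /=; rewrite mulrDr. Qed.
Fact fps_scaleDl f : {morph fps_scale^~ f : a b / a + b}.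
Proof. by move=> a b; apply/fpsP => n /=; rewrite mulrDl. Qed.

HB.instance Definition _ := GRing.Zmodule_isLmodule.Build k (fps k)
  fps_scaleA fps_scale1 fps_scaleDr fps_scaleDl.

Fact fps_scaleAl (a : k) f g : a *: (f * g) = a *: f * g.
Proof.
apply/fpsP => n /=; rewrite mulr_sumr.
by apply: eq_bigr => i _; rewrite mulrA.
Qed.

HB.instance Definition _ := GRing.Lmodule_isLalgebra.Build k (fps k) fps_scaleAl.
HB.instance Definition _ := GRing.Lalgebra_isComAlgebra.Build k (fps k).

Fixpoint fps_inv_seq f n : seq k :=
  if n is m.+1 then
    let s := fps_inv_seq f m in
    rcons s ((f 0%N)^-1 * ((m == 0%N)%:R - \sum_(i < m) s`_i * f (m - i)%N))
  else [::].

Definition fps_unit f := f 0%N != 0.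
Definition fps_inv f : fps k :=
  if f 0%N == 0 then f else Fps (fun n => (fps_inv_seq f n.+1)`_n).

Lemma size_fps_inv_seq f n : size (fps_inv_seq f n) = n.
Proof. by elim: n => //= n IHn; rewrite size_rcons IHn. Qed.

Lemma nth_fps_inv_seq f n i : (i < n)%N ->
  (fps_inv_seq f n)`_i = (fps_inv_seq f i.+1)`_i.
Proof.
elim: n => // n IHn; rewrite ltnS leq_eqVlt => /predU1P[-> // | lt_in].
by rewrite {1}/fps_inv_seq -/fps_inv_seq nth_rcons size_fps_inv_seq lt_in IHn.
Qed.

Fact fps_mulVr f : fps_unit f -> fps_inv f * f = 1.
Proof.
rewrite /fps_unit => f0; apply/fpsP => n.
rewrite /fps_inv (negPf f0) [LHS]/= big_ord_recr subnn.
set s := fps_inv_seq f.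
have -> : \sum_(i < n) Fps (fun n => (s n.+1)`_n) (widen_ord (leqnSn n) i)
    * f (n - widen_ord (leqnSn n) i)%N = \sum_(i < n) (s n)`_i * f (n - i)%N.
  by apply: eq_bigr => i _; rewrite /= [in RHS]nth_fps_inv_seq.
rewrite /= nth_rcons size_fps_inv_seq ltnn eqxx mulrAC mulVf // mul1r.
by rewrite addrC subrK.
Qed.

Fact fps_unitP f g : g * f = 1 -> fps_unit f.
Proof.
move=> /fpsP/(_ 0%N); rewrite /= big_ord1 /= /fps_unit => gf1.
by apply/eqP => f0; move/eqP: gf1; rewrite f0 mulr0 eq_sym oner_eq0.
Qed.

Fact fps_inv_out : {in [predC fps_unit], fps_inv =1 id}.
Proof. by move=> f; rewrite inE negbK /fps_inv => ->. Qed.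

HB.instance Definition _ := GRing.ComNzRing_hasMulInverse.Build (fps k)
  fps_mulVr fps_unitP fps_inv_out.

Fact fps_idomain f g : f * g = 0 -> (f == 0) || (g == 0).
Proof.
have least h : h != 0 ->
    exists m, h m != 0 /\ forall i, (i < m)%N -> h i = 0.
  move=> h_neq0; have ex_h : exists m, h m != 0.
    apply: contrapT => no_m; case/eqP: h_neq0; apply/fpsP => n.
    by apply/eqP/negPn/negP => hn; apply: no_m; exists n.
  case: (ex_minnP ex_h) => m hm min_m; exists m; split=> // i lt_im.
  by apply/eqP/negPn/negP => /min_m; rewrite leqNgt lt_im.
move=> fg0; case: (eqVneq f 0) => //= /least[m [fm lt_m]].
case: (eqVneq g 0) => // /least[l [gl lt_l]].
move/fpsP/(_ (m + l)%N): fg0; rewrite /= => /eqP.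
have lt_m1 : (m < (m + l).+1)%N by rewrite ltnS leq_addr.
rewrite (bigD1 (Ordinal lt_m1)) //= addKn big1 ?addr0.
  by rewrite mulf_eq0 (negPf fm) (negPf gl).
move=> i; rewrite -val_eqE /= => ne_im.
case: (ltngtP i m) ne_im => // [lt_im|lt_mi] _; first by rewrite lt_m ?mul0r.
have le_i : (i <= m + l)%N by rewrite -ltnS.
by rewrite lt_l ?mulr0 // -(ltn_add2r i) subnK // [X in (_ < X)%N]addnC ltn_add2r.
Qed.

HB.instance Definition _ :=
  GRing.ComUnitRing_isIntegral.Build (fps k) fps_idomain.

Definition fpsX : fps k := Fps (fun n => (n == 1%N)%:R).

End PowerSeries.

Section Automorphisms.
Variable k : fieldType.

Record fps_aut := FpsAut {
  aut_fun :> fps k -> fps k;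
  aut_linear : linear aut_fun;
  aut_monoid_morphism : monoid_morphism aut_fun;
  aut_bij : bijective aut_fun
}.
Implicit Types s u v : fps_aut.

HB.instance Definition _ := gen_eqMixin fps_aut.
HB.instance Definition _ := gen_choiceMixin fps_aut.

Lemma fps_autP s u : s =1 u -> s = u.
Proof.
case: s u => [f lf mf bf] [g lg mg bg] /= /funext eq_fg.
rewrite {}eq_fg in lf mf bf *.
by congr FpsAut; apply: Prop_irrelevance.
Qed.

Definition fps_aut_one : fps_aut.
Proof. by exists id => //; exists id. Defined.

Definition fps_aut_mul s u : fps_aut.
Proof.
exists (s \o u).
- by move=> c f g /=; rewrite aut_linear aut_linear.
- have [s1 sM] := aut_monoid_morphism s; have [u1 uM] := aut_monoid_morphism u.
  by split=> [|f g] /=; rewrite ?u1 // uM sM.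
- exact: bij_comp (aut_bij s) (aut_bij u).
Defined.

Lemma aut_inv_ex s : exists g, cancel s g /\ cancel g s.
Proof. by case: (aut_bij s) => g sK gK; exists g. Qed.

Definition aut_inv_fun s : fps k -> fps k := sval (cid (aut_inv_ex s)).
Lemma aut_invK s : cancel s (aut_inv_fun s).
Proof. by case: (svalP (cid (aut_inv_ex s))). Qed.
Lemma aut_invKV s : cancel (aut_inv_fun s) s.
Proof. by case: (svalP (cid (aut_inv_ex s))). Qed.

Definition fps_aut_inv s : fps_aut.
Proof.
exists (aut_inv_fun s).
- move=> c x y; apply: (can_inj (aut_invK s)).
  by rewrite aut_linear !aut_invKV.
- have [s1 sM] := aut_monoid_morphism s.
  by split=> [|x y]; apply: (can_inj (aut_invK s)); rewrite ?sM !aut_invKV ?s1.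
- by exists s; [exact: aut_invKV | exact: aut_invK].
Defined.

Fact fps_aut_mulA : associative fps_aut_mul.
Proof. by move=> s u v; apply: fps_autP. Qed.
Fact fps_aut_mul1 : left_id fps_aut_one fps_aut_mul.
Proof. by move=> s; apply: fps_autP. Qed.
Fact fps_aut_mulr1 : right_id fps_aut_one fps_aut_mul.
Proof. by move=> s; apply: fps_autP. Qed.
Fact fps_aut_mulV : left_inverse fps_aut_one fps_aut_inv fps_aut_mul.
Proof.
by move=> s; apply: fps_autP => f; exact: aut_invK.
Qed.
Fact fps_aut_mulrV : right_inverse fps_aut_one fps_aut_inv fps_aut_mul.
Proof.
by move=> s; apply: fps_autP => f; exact: aut_invKV.
Qed.

HB.instance Definition _ := isGroup.Build fps_aut fps_aut_mulA
  fps_aut_mul1 fps_aut_mulr1 fps_aut_mulV fps_aut_mulrV.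

End Automorphisms.

Section Groups.
Variable G : groupType.
Implicit Types s u : G.

Definition subgroup_gen s : set G :=
  smallest (fun H : set G => group_closed [in H]) [set s].

Definition has_order s (m : nat) : Prop :=
  [/\ (0 < m)%N, (s ^+ m = 1)%g
    & forall j, (0 < j < m)%N -> (s ^+ j <> 1)%g].

Definition conjugate s u : Prop := exists v, u = (s ^ v)%g.

End Groups.

(* The Artin-Schreier operator. *)
Definition wp (R : nzRingType) (p : nat) (x : R) : R := x ^+ p - x.

(* For a field [k] of characteristic [p]. *)
Definition perfect (k : fieldType) (p : nat) : Prop :=
  forall x : k, exists y, y ^+ p = x.

Section LaurentSeries.
Variable k : fieldType.

(* k((t)) is the fraction field of k[[t]]. *)
Definition laurent := {fraction (fps k)}.
HB.instance Definition _ := GRing.Field.on laurent.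

Definition to_laurent (f : fps k) : laurent := @FracField.tofrac (fps k) f.

(* The subfield k(X) of k((t)). *)
Definition adjoin (X : set laurent) : set laurent :=
  smallest (fun F : set laurent => divring_closed [in F])
    (range (fun c : k => to_laurent c%:A) `|` X).

Local Notation t := (to_laurent (fpsX k)).

(* [~ adjoin [set t] beta] excludes the trivial extension: it amounts to
   requiring that the extension has degree p, i.e. has Galois group Z/pZ. *)
Definition artin_schreier_ext (p : nat) (L : set laurent) : Prop :=
  exists beta : laurent,
    [/\ adjoin [set t] (wp p beta), ~ adjoin [set t] beta
      & L = adjoin [set t; beta]].

Definition almost_rational (p : nat) (s : fps_aut k) : Prop :=
  (exists m, has_order s m) /\
  artin_schreier_ext p
    (adjoin [set to_laurent (u (fpsX k)) | u in subgroup_gen s]).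

Definition is_beta (b : k) (beta : fps k) : Prop :=
  let t := fpsX k in
  (exists c, beta = t * c) /\
  beta ^+ 2 - beta = t ^+ 3 + (b ^+ 2 + b + 1) *: t ^+ 2.

Definition is_sigma (b : k) (beta : fps k) (s : fps_aut k) : Prop :=
  let t := fpsX k in
  to_laurent (s t) =
    to_laurent (b ^+ 2 *: t + (b + 1) *: t ^+ 2 + beta)
      / to_laurent ((b ^+ 2)%:A + t ^+ 2).

End LaurentSeries.

(* Main.v *)
(** Let v be the t-adic valuation of K = k((t)) and L = k(t, beta), on which sigma
    acts. Put rho = sigma^(p^(n-1)), of order p, and m = v(rho t - t) - 1.

    Lower bound on m: let tau^p = rho and i = v(tau t - t) - 1 >= 1, and choose z in
    K with rho z = z + 1 and v(z) = -m. Then h = tau z - z has v(h) >= i - m and is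
    fixed by rho, and elements fixed by rho have valuation in pZ; so each of the
    p - 1 applications of tau - 1 that lead from h to
    (tau - 1)^p z = (tau^p - 1) z = 1 raises the valuation by at least p. Hence
    m >= p (p - 1) + i.

    Upper bound on m: t and rho t generate over each other extensions of degree at
    most p inside L, hence by Gauss's lemma they satisfy a polynomial relation of
    bidegree (p, p); restricting it to the diagonal gives m + 1 <= 2p.

    So p = 2 and m = 3. If n > 2, one can take for tau a square, so that i >= 2,
    which is absurd; so n = 2.

    The relation between t and rho t is then symmetric and its diagonal is a multiple
    of T^4; with w = (1/t + 1/rho t)^(-1) and y = w / t it becomes a Weierstrass
    equation in which rho w = w and rho y = y + 1. Integrality over k[w] forces
    sigma w = w + B and sigma y - y in k + k w, and a change of coordinates gives
      y^2 + y = x^3 + (b^2 + b + 1) x^2, sigma x = x + 1, sigma y = y + x + b.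
    On this curve y / x^2 is a uniformizer (the abscissa after translation by the
    point (0, 0)), and in it sigma is given by the formula of sigma_b. Conversely the
    formula of sigma_b gives such x and y, and comparing the leading terms of two
    such pairs for the same sigma yields b' - b = wp(d), where d is the constant
    term of x' - x. *)
Require Import Defs.
From HB Require Import structures.
From mathcomp Require Import all_boot all_order all_algebra.
From mathcomp Require Import boolp classical_sets.
From mathcomp Require Import zify ring.

Set Implicit Arguments.
Unset Strict Implicit.
Unset Printing Implicit Defensive.

Import Order.TTheory GRing.Theory Num.Theory.

Local Open Scope ring_scope.

(** * The valuation of k((t)) *)

Lemma frac_repr (R : idomainType) (x : {fraction R}) :
  exists f g, g != 0 /\ x = FracField.tofrac f / FracField.tofrac g.
Proof.
pose r := repr x; exists \n_r, \d_r; split; first exact: denom_ratioP.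
apply: (mulIf (x := FracField.tofrac \d_r)); first by rewrite tofrac_eq0 denom_ratioP.
rewrite divfK ?tofrac_eq0 ?denom_ratioP // -[x in LHS]reprK -/r.
unlock FracField.tofrac; rewrite -[LHS]FracField.pi_mul.
apply/eqmodP; rewrite /= FracField.equivfE /FracField.mulf.
by rewrite !numden_Ratio ?(mulr1, oner_eq0) // ?denom_ratioP // mulrC.
Qed.

Section Valuation.
Variable k : fieldType.
Local Notation K := (laurent k).
Implicit Types (x y z : K) (f g : fps k) (m n : int) (P Q : {poly k}).

HB.instance Definition _ :=
  GRing.RMorphism.copy (@to_laurent k) (@FracField.tofrac (fps k)).

Definition cst (c : k) : K := to_laurent c%:A.
HB.instance Definition _ :=
  GRing.RMorphism.copy cst (@to_laurent k \o in_alg (fps k)).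

Definition laurent_t : K := to_laurent (fpsX k).
Local Notation t := laurent_t.

Lemma to_laurent_inj : injective (@to_laurent k).
Proof. by move=> f g /eqP; rewrite tofrac_eq => /eqP. Qed.

Lemma coef_fpsXM f (n : nat) : (fpsX k * f) n = if n is i.+1 then f i else 0.
Proof.
rewrite [LHS]/=; case: n => [|n]; first by rewrite big_ord1 mul0r.
rewrite big_ord_recl big_ord_recl big1 /= => [|i _]; last by rewrite mul0r.
by rewrite mul0r mul1r add0r addr0 subn1.
Qed.

Lemma coef_fpsXnM i f (n : nat) :
  (fpsX k ^+ i * f) n = if (n < i)%N then 0 else f (n - i)%N.
Proof.
elim: i n => [|i IHi] n; first by rewrite mul1r subn0.
rewrite exprS -mulrA coef_fpsXM; case: n => // n; exact: IHi.
Qed.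

Lemma coef_fpsD f g (n : nat) : (f + g) n = f n + g n.
Proof. by []. Qed.

Lemma coef_fpsN f (n : nat) : (- f) n = - f n.
Proof. by []. Qed.

Lemma coef_fpsM0 f g : (f * g) 0%N = f 0%N * g 0%N.
Proof. by rewrite [LHS]/= big_ord1. Qed.

Lemma coef_fpsA (c : k) (n : nat) : (c%:A : fps k) n = if n == 0%N then c else 0.
Proof. by rewrite /= mulr_natr mulrb. Qed.

Lemma fps_unitE f : (f \is a GRing.unit) = (f 0%N != 0).
Proof. by []. Qed.

Lemma fpsX_neq0 : fpsX k != 0.
Proof. by apply/eqP => /fpsP/(_ 1%N)/eqP; rewrite /= oner_eq0. Qed.

Lemma fps_split f : exists g, f = (f 0%N)%:A + fpsX k * g.
Proof.
exists (Fps (fun n : nat => f n.+1)); apply/fpsP => -[|n].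
  by rewrite coef_fpsD coef_fpsA coef_fpsXM addr0.
by rewrite coef_fpsD coef_fpsA coef_fpsXM add0r.
Qed.

Lemma fps_splitn N f : (forall i, (i < N)%N -> f i = 0) ->
  exists g, f = fpsX k ^+ N * g.
Proof.
move=> f0; exists (Fps (fun n : nat => f (n + N)%N)); apply/fpsP => n.
rewrite coef_fpsXnM; case: ltnP => [/f0 //|leNn] /=.
by rewrite subnK.
Qed.

Lemma t_neq0 : t != 0.
Proof. by rewrite tofrac_eq0 fpsX_neq0. Qed.

(* [vge m x] is v(x) >= m, [hval x m] is v(x) = m, for the t-adic valuation v. *)
Definition vge m x : Prop := exists f, x = t ^ m * to_laurent f.
Definition hval x m : Prop := exists2 f : fps k, f 0%N != 0 & x = t ^ m * to_laurent f.

Lemma vge_fps f : vge 0 (to_laurent f).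
Proof. by exists f; rewrite expr0z mul1r. Qed.

Lemma vge_le m n x : n <= m -> vge m x -> vge n x.
Proof.
move=> le_nm [f ->]; exists (fpsX k ^+ `|m - n|%N * f).
rewrite rmorphM rmorphXn /= mulrA -[X in t ^ n * X]/(t ^ (`|m - n|%N : int)).
rewrite -expfzDr ?t_neq0 //; congr (t ^ _ * _); lia.
Qed.

Lemma vgeD m x y : vge m x -> vge m y -> vge m (x + y).
Proof. by move=> [f ->] [g ->]; exists (f + g); rewrite rmorphD mulrDr. Qed.

Lemma vgeN m x : vge m x -> vge m (- x).
Proof. by move=> [f ->]; exists (- f); rewrite rmorphN mulrN. Qed.

Lemma vgeB m x y : vge m x -> vge m y -> vge m (x - y).
Proof. by move=> hx hy; apply: vgeD => //; apply: vgeN. Qed.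

Lemma vge0 m : vge m 0.
Proof. by exists 0; rewrite rmorph0 mulr0. Qed.

Lemma vgeM m n x y : vge m x -> vge n y -> vge (m + n) (x * y).
Proof.
move=> [f ->] [g ->]; exists (f * g).
by rewrite expfzDr ?t_neq0 // rmorphM mulrACA.
Qed.

Lemma vgeM0 m x y : vge m x -> vge 0 y -> vge m (x * y).
Proof. by move=> hx hy; rewrite -[m]addr0; apply: vgeM. Qed.

Lemma vge_cst (c : k) : vge 0 (cst c).
Proof. exact: vge_fps. Qed.

Lemma hval_vge x m : hval x m -> vge m x.
Proof. by move=> [f _ ->]; exists f. Qed.

Lemma hval_neq0 x m : hval x m -> x != 0.
Proof.
move=> [f f0 ->]; rewrite mulf_neq0 ?expfz_neq0 ?t_neq0 //.
by rewrite tofrac_eq0; apply: contraNneq f0 => ->.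
Qed.

Lemma hval_t : hval t 1.
Proof. by exists 1; rewrite ?oner_eq0 // rmorph1 mulr1 expr1z. Qed.

Lemma hval1 : hval 1 0.
Proof. by exists 1; rewrite ?oner_eq0 // rmorph1 mulr1 expr0z. Qed.

Lemma hvalM m n x y : hval x m -> hval y n -> hval (x * y) (m + n).
Proof.
move=> [f f0 ->] [g g0 ->]; exists (f * g); first by rewrite coef_fpsM0 mulf_neq0.
by rewrite expfzDr ?t_neq0 // rmorphM mulrACA.
Qed.

Lemma hvalV m x : hval x m -> hval x^-1 (- m).
Proof.
move=> [f f0 ->]; exists f^-1.
  have := f0; rewrite -fps_unitE => uf.
  by rewrite -fps_unitE unitrV.
rewrite invfM invr_expz; congr (_ * _); apply: (mulfI (x := to_laurent f)).
  by rewrite tofrac_eq0; apply: contraNneq f0 => ->.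
rewrite mulfV -?rmorphM ?divrr ?rmorph1 //.
by rewrite tofrac_eq0; apply: contraNneq f0 => ->.
Qed.

Lemma hvalX m x i : hval x m -> hval (x ^+ i) (m * i%:Z).
Proof.
move=> vx; elim: i => [|i IHi]; first by rewrite mulr0; exact: hval1.
by rewrite exprS intS mulrDr mulr1; apply: hvalM.
Qed.

Lemma hval_cst (c : k) : c != 0 -> hval (cst c) 0.
Proof. by move=> c0; exists c%:A; rewrite ?expr0z ?mul1r // coef_fpsA. Qed.

Lemma vge1_fps f : vge 1 (to_laurent f) -> f 0%N = 0.
Proof.
move=> [g]; rewrite expr1z -rmorphM => /to_laurent_inj ->.
exact: coef_fpsXM.
Qed.

Lemma hval_vge_le x m n : hval x m -> vge n x -> n <= m.
Proof.
move=> vx xn; rewrite leNgt; apply/negP => lt_mn.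
have [f f0 xE] := vx.
have : vge 1 (t ^ (- m) * x).
  apply: vge_le (_ : - m + n >= 1) _; first by lia.
  by apply: vgeM => //; exists 1; rewrite rmorph1 mulr1.
rewrite xE mulrA -expfzDr ?t_neq0 // addNr expr0z mul1r => /vge1_fps fe.
by rewrite fe eqxx in f0.
Qed.

Lemma hval_uniq x m n : hval x m -> hval x n -> m = n.
Proof.
by move=> hm hn; apply/le_anti/andP; split;
  [apply: hval_vge_le hn _|apply: hval_vge_le hm _]; apply: hval_vge.
Qed.

Lemma fps_order f : f != 0 -> exists N g, g 0%N != 0 /\ f = fpsX k ^+ N * g.
Proof.
move=> f_neq0; have ex_f : exists m : nat, f m != 0.
  apply: contrapT => no_m; case/eqP: f_neq0; apply/fpsP => n.
  by apply/eqP/negPn/negP => hn; apply: no_m; exists n.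
case: (ex_minnP ex_f) => m fm min_m.
have [|g fE] := @fps_splitn m f.
  by move=> i lt_im; apply/eqP/negPn/negP => /min_m; rewrite leqNgt lt_im.
exists m, g; split=> //; apply: contraNneq fm.
by rewrite fE coef_fpsXnM ltnn subnn => ->.
Qed.

Lemma laurent_frac x : exists f g, g != 0 /\ x = to_laurent f / to_laurent g.
Proof.
have [f [g [g0 xE]]] := frac_repr x.
by exists f, g.
Qed.

Lemma hvalP x : x != 0 -> exists m, hval x m.
Proof.
have vf f : f != 0 -> exists m, hval (to_laurent f) m.
  move=> /fps_order[N [g [g0 ->]]]; exists N%:Z, g => //.
  by rewrite rmorphM rmorphXn.
have [f [g [g0 ->]]] := laurent_frac x.
rewrite mulf_eq0 invr_eq0 !tofrac_eq0 negb_or => /andP[/vf[m fm] /vf[n gn]].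
by exists (m - n); apply: hvalM => //; apply: hvalV.
Qed.

Lemma hval_of_vge x m : vge m x -> x != 0 -> exists2 n, m <= n & hval x n.
Proof.
by move=> xm /hvalP[n xn]; exists n => //; apply: hval_vge_le xm.
Qed.

Lemma vge_all_eq0 x : (forall m, vge m x) -> x = 0.
Proof.
move=> h; apply/eqP/negPn/negP => /hvalP[m xm].
by have := hval_vge_le xm (h (m + 1)); lia.
Qed.

(** The residue field is [k]: the quotient of the coefficients of order [m] is a constant that
    cancels the leading term, and it is 0 when [y] has larger order. *)
Lemma hval_lead x y m : hval x m -> vge m y -> exists c, vge (m + 1) (y - cst c * x).
Proof.
move=> [f f0 ->] [g ->]; exists (g 0%N / f 0%N).
have [h hE] := fps_split (g - (g 0%N / f 0%N)%:A * f).
rewrite mulrCA /cst -mulrBr -rmorphM -rmorphB hE.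
have -> : (g - (g 0%N / f 0%N)%:A * f) 0%N = 0.
  by rewrite coef_fpsD coef_fpsN coef_fpsM0 coef_fpsA /= divfK // subrr.
rewrite scale0r add0r rmorphM mulrA; exists h.
by rewrite expfzDr ?t_neq0 // expr1z.
Qed.

Lemma hvalD x y m : hval x m -> vge (m + 1) y -> hval (x + y) m.
Proof.
move=> [f f0 ->] [g ->]; exists (f + fpsX k * g).
  by rewrite coef_fpsD coef_fpsXM addr0.
by rewrite rmorphD mulrDr rmorphM mulrA expfzDr ?t_neq0 // expr1z.
Qed.

Lemma hvalN x m : hval x m -> hval (- x) m.
Proof.
by move=> [f f0 ->]; exists (- f); rewrite ?rmorphN ?mulrN // /= oppr_eq0.
Qed.

Lemma vge0P x : vge 0 x -> exists f, x = to_laurent f.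
Proof. by move=> [f ->]; exists f; rewrite expr0z mul1r. Qed.

Lemma cst_inj c d : cst c = cst d -> c = d.
Proof.
move=> /eqP; rewrite -subr_eq0 -rmorphB => /eqP cd; apply/eqP; rewrite -subr_eq0.
by apply/negPn/negP => /hval_cst/hval_neq0; rewrite cd eqxx.
Qed.

Lemma vge1_cst c : vge 1 (cst c) -> c = 0.
Proof.
move=> c1; apply/eqP/negPn/negP => /hval_cst/hval_vge_le/(_ c1); lia.
Qed.

End Valuation.

(** * Automorphisms and ramification breaks *)

Section FractionLift.
Variables (R : idomainType) (F : fieldType) (phi : {rmorphism R -> F}).
Hypothesis phi_inj : injective phi.
Local Notation tofrac := (@FracField.tofrac R).

Lemma fraction_lift_subproof (x : {fraction R}) :
  exists fg : R * R, fg.2 != 0 /\ x = tofrac fg.1 / tofrac fg.2.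
Proof. by have [f [g ?]] := frac_repr x; exists (f, g). Qed.

(** Numerator and denominator are picked by choice; [fraction_liftE] shows that the value does not
    depend on them, injectivity of [phi] keeping the denominators nonzero. *)
Definition fraction_lift (x : {fraction R}) : F :=
  let fg := sval (cid (fraction_lift_subproof x)) in phi fg.1 / phi fg.2.

Lemma fraction_liftE f g :
  g != 0 -> fraction_lift (tofrac f / tofrac g) = phi f / phi g.
Proof.
have phi0 h : (phi h == 0) = (h == 0) by rewrite -(inj_eq phi_inj) rmorph0.
move=> g0; rewrite /fraction_lift; case: cid => -[a b] /= [b0].
move/eqP; rewrite eqr_div ?tofrac_eq0 // -!rmorphM tofrac_eq => /eqP fb.
by apply/eqP; rewrite eqr_div ?phi0 // -!rmorphM fb.
Qed.

Lemma fraction_lift_tofrac f : fraction_lift (tofrac f) = phi f.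
Proof.
by have := @fraction_liftE f 1 (oner_neq0 _); rewrite !rmorph1 !divr1.
Qed.

Lemma fraction_lift_zmod_morphism : zmod_morphism fraction_lift.
Proof.
have phi0 h : (phi h == 0) = (h == 0) by rewrite -(inj_eq phi_inj) rmorph0.
move=> x y; have [f [g [g0 ->]]] := frac_repr x.
have [f' [g' [g0' ->]]] := frac_repr y.
rewrite -mulNr -rmorphN addf_div ?tofrac_eq0 // -!rmorphM -rmorphD.
rewrite !fraction_liftE ?mulf_neq0 // !(rmorphD, rmorphM, rmorphN) mulNr.
by rewrite -[in RHS]mulNr addf_div ?phi0 // mulNr.
Qed.

Lemma fraction_lift_monoid_morphism : monoid_morphism fraction_lift.
Proof.
have phi0 h : (phi h == 0) = (h == 0) by rewrite -(inj_eq phi_inj) rmorph0.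
split=> [|x y].
  by rewrite -[X in fraction_lift X](rmorph1 tofrac) fraction_lift_tofrac rmorph1.
have [f [g [g0 ->]]] := frac_repr x; have [f' [g' [g0' ->]]] := frac_repr y.
rewrite mulf_div -!rmorphM !fraction_liftE ?mulf_neq0 //.
by rewrite !rmorphM mulf_div.
Qed.

End FractionLift.

(** First-order inverse of [x = 1 + a * e + r] with [r] eliminated: every term of the correction
    contains [e * e] or [r]. *)
Lemma inverse_expansion (F : fieldType) (x a e : F) : x != 0 ->
  x^-1 = 1 + - a * e
         + x^-1 * (a * a * (e * e) + a * e * (x - 1 - a * e) - (x - 1 - a * e)).
Proof. by move=> x0; field. Qed.

Section Automorphisms.
Variable k : fieldType.
Local Notation K := (laurent k).
Local Notation t := (laurent_t k).
Implicit Types (x y z : K) (f g : fps k) (m n : int) (s u : fps_aut k).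

Fact aut_zmod_morphism s : zmod_morphism (aut_fun s).
Proof. by move=> f g; rewrite -scaleN1r addrC aut_linear scaleN1r addrC. Qed.
HB.instance Definition _ s :=
  GRing.isZmodMorphism.Build _ _ (aut_fun s) (aut_zmod_morphism s).
HB.instance Definition _ s :=
  GRing.isMonoidMorphism.Build _ _ (aut_fun s) (aut_monoid_morphism s).

Lemma autZ s c f : s (c *: f) = c *: s f.
Proof. by have := aut_linear s c f 0; rewrite rmorph0 !addr0. Qed.

Lemma autA s c : s c%:A = c%:A.
Proof. by rewrite autZ rmorph1. Qed.

Lemma aut_laurent_inj s : injective (@to_laurent k \o s).
Proof. exact: inj_comp (@to_laurent_inj k) (bij_inj (aut_bij s)). Qed.

Lemma aut_laurent s :
  {phi : {rmorphism K -> K} | forall f, phi (to_laurent f) = to_laurent (s f)}.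
Proof.
pose phi := fraction_lift (@to_laurent k \o s).
pose phiB := GRing.isZmodMorphism.Build K K phi
  (fraction_lift_zmod_morphism (@aut_laurent_inj s)).
pose phiM := GRing.isMonoidMorphism.Build K K phi
  (fraction_lift_monoid_morphism (@aut_laurent_inj s)).
exists (HB.pack_for {rmorphism K -> K} phi phiB phiM) => f.
exact: (fraction_lift_tofrac (@aut_laurent_inj s)).
Qed.

(* The extension of [s] to k((t)). *)
Definition sg s : K -> K := sval (aut_laurent s).
HB.instance Definition _ s := GRing.RMorphism.copy (sg s) (sval (aut_laurent s)).

Lemma sg_fps s f : sg s (to_laurent f) = to_laurent (s f).
Proof. exact: (svalP (aut_laurent s)). Qed.

Lemma sg_cst s c : sg s (cst c) = cst c.
Proof. by rewrite sg_fps autA. Qed.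

Lemma sgM s u x : sg (s * u)%g x = sg s (sg u x).
Proof.
have [f [g [g0 ->]]] := laurent_frac x.
by rewrite !fmorph_div /= !sg_fps.
Qed.

Lemma sg1 x : sg 1%g x = x.
Proof.
by have [f [g [g0 ->]]] := laurent_frac x; rewrite fmorph_div /= !sg_fps.
Qed.

Lemma sgX s i x : sg (s ^+ i)%g x = iter i (sg s) x.
Proof.
elim: i => [|i IHi]; first by rewrite expg0 sg1.
by rewrite expgS sgM IHi.
Qed.

Lemma sgV s x y : sg s x = y -> sg s^-1%g y = x.
Proof. by move=> <-; rewrite -sgM mulVg sg1. Qed.

(** Automorphisms preserve units, so [u t] is not a unit, else [t] would be one. The same fact for
    the inverse automorphism forces the cofactor to be a unit. *)
Lemma aut_t s : exists2 f : fps k, f 0%N != 0 & s (fpsX k) = fpsX k * f.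
Proof.
have tail u : exists f, u (fpsX k) = fpsX k * f.
  have [f fE] := fps_split (u (fpsX k)); exists f.
  have [u0|u0] := eqVneq (u (fpsX k) 0%N) 0; first by rewrite u0 scale0r add0r in fE.
  have : u^-1%g (u (fpsX k)) \is a GRing.unit by apply: rmorph_unit.
  rewrite -[_ (u _)]/((u^-1 * u)%g (fpsX k)) mulVg /=.
  by rewrite fps_unitE eqxx.
have [f fE] := tail s; exists f => //; have [g gE] := tail s^-1%g.
have : s^-1%g f \is a GRing.unit.
  have : s^-1%g (s (fpsX k)) = fpsX k by rewrite -[LHS]/((s^-1 * s)%g (fpsX k)) mulVg.
  rewrite fE rmorphM [X in X * _]gE -mulrA -[RHS]mulr1 => /(mulfI (fpsX_neq0 k)) gf.
  by apply/unitrPr; exists g; rewrite mulrC.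
move=> /(rmorph_unit s) /=; rewrite -[s (_ f)]/((s * s^-1)%g f) mulgV.
by rewrite fps_unitE.
Qed.

Lemma hval_sg s x m : hval x m -> hval (sg s x) m.
Proof.
have vt : hval (sg s t) 1.
  have [f f0 fE] := aut_t s; exists f => //.
  by rewrite sg_fps fE rmorphM expr1z.
have vtz (n : int) : hval (sg s (t ^ n)) n.
  rewrite /exprz; case: n => i; first by rewrite rmorphXn -[Posz i]mul1r; apply: hvalX.
  rewrite fmorphV rmorphXn NegzE; apply: hvalV; rewrite -[Posz _]mul1r; exact: hvalX.
move=> [f f0 ->]; rewrite rmorphM /= -[X in hval _ X]addr0; apply: hvalM => //.
rewrite sg_fps; exists (s f); last by rewrite expr0z mul1r.
by rewrite -fps_unitE rmorph_unit.
Qed.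

Lemma vge_sg s x m : vge m x -> vge m (sg s x).
Proof.
move=> xm; have [->|x0] := eqVneq x 0; first by rewrite rmorph0; apply: vge0.
have [n le_mn xn] := hval_of_vge xm x0.
by apply: vge_le le_mn _; apply/hval_vge/hval_sg.
Qed.

(** * How an automorphism of given depth moves elements of given valuation *)

Section Depth.
Variables (s : fps_aut k) (b : int).
Hypotheses (b_gt0 : 1 <= b) (dge_s : vge (b + 1) (sg s t - t)).

(** No continuity is assumed: each induction step splits off the constant term, which [s] fixes, and
    the factor [t] of the rest gains one order, up to [b + 1]. *)
Lemma sgB_fps f : vge (b + 1) (sg s (to_laurent f) - to_laurent f).
Proof.
suff H (N : nat) : N%:Z <= b + 1 ->
    forall f, vge N%:Z (sg s (to_laurent f) - to_laurent f).
  have -> : b + 1 = `|(b + 1)%R|%N%:Z by lia.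
  apply: H; lia.
elim: N => [|N IHN] leN h; first by apply: vgeB; [apply: vge_sg|]; apply: vge_fps.
have [g ->] := fps_split h; rewrite !(rmorphD, rmorphM) /=.
rewrite -/(cst (h 0%N)) -/t sg_cst opprD addrACA subrr add0r.
have -> : sg s t * sg s (to_laurent g) - t * to_laurent g =
  (sg s t - t) * sg s (to_laurent g) + t * (sg s (to_laurent g) - to_laurent g) by ring.
apply: vgeD.
  by apply: vgeM0; [apply: vge_le dge_s|apply/vge_sg/vge_fps].
rewrite intS; apply: vgeM; first exact/hval_vge/hval_t.
by apply: IHN; lia.
Qed.

Local Notation eps := (sg s t / t - 1).

Lemma vge_eps : vge b eps.
Proof.
have -> : eps = (sg s t - t) / t by rewrite mulrBl divff ?t_neq0.
rewrite -[X in vge X](addrK 1 b); apply: vgeM => //.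
exact/hval_vge/hvalV/hval_t.
Qed.

(* For a unit of k[[t]] the ratio [s x / x] is 1 up to order b + 1, and
   [x |-> s x / x] is multiplicative, so only the power of t matters. *)
Lemma sg_ratio x m : hval x m -> vge (b + 1) (sg s x / x - 1 - cst m%:~R * eps).
Proof.
(* [a] is the first-order coefficient of [s y / y]; it is additive in products because [eps * eps]
   is negligible. *)
pose E (a : k) y := exists2 r, vge (b + 1) r & sg s y / y = 1 + cst a * eps + r.
have eps2 : vge (b + 1) (eps * eps).
  by apply: vge_le (vgeM vge_eps vge_eps); lia.
have vb (r : K) : vge (b + 1) r -> vge 0 r by apply: vge_le; lia.
have v1 : vge 0 (1 : K) by exact/hval_vge/hval1.
have vc a : vge 0 (cst a) by apply: vge_cst.
have ve : vge 0 eps by apply: vge_le vge_eps; lia.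
have EM a a' y y' : E a y -> E a' y' -> E (a + a') (y * y').
  move=> [r rE yE] [r' rE' yE'].
  exists (cst a * cst a' * (eps * eps) + r * (1 + cst a' * eps + r')
          + r' * (1 + cst a * eps)); last first.
    by rewrite rmorphM -mulf_div yE yE' rmorphD; ring.
  apply: vgeD; first apply: vgeD.
  - by rewrite mulrC; apply: vgeM0 => //; apply: (@vgeM0 _ 0).
  - by apply: vgeM0 => //; apply: vgeD; [apply: vgeD => //; apply: (@vgeM0 _ 0)|apply: vb].
  - by apply: vgeM0 => //; apply: vgeD => //; apply: (@vgeM0 _ 0).
have EV a y n : hval y n -> E a y -> E (- a) y^-1.
  move=> yn [r rE yE]; set A := sg s y / y.
  have vA : hval A 0 by rewrite -(subrr n); apply: hvalM; [apply: hval_sg|apply: hvalV].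
  exists (A^-1 * (cst a * cst a * (eps * eps) + cst a * eps * r - r)).
    rewrite mulrC; apply: vgeM0; last by apply: vge_le (hval_vge (hvalV vA)); lia.
    apply: vgeB => //; apply: vgeD; last by rewrite mulrC; apply: vgeM0 => //; apply: (@vgeM0 _ 0).
    by rewrite mulrC; apply: vgeM0 => //; apply: (@vgeM0 _ 0).
  have A0 := hval_neq0 vA.
  have -> : sg s y^-1 / y^-1 = A^-1 by rewrite fmorphV invfM !invrK mulrC.
  have rD : r = A - 1 - cst a * eps by rewrite /A yE; ring.
  by rewrite rD rmorphN; apply: inverse_expansion.
have Et : E 1 t by exists 0; [apply: vge0|rewrite rmorph1; ring].
have EX (i : nat) : E i%:R (t ^+ i).
  elim: i => [|i IHi]; last by rewrite exprS -natr1 addrC; apply: EM.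
  by exists 0; [apply: vge0|rewrite rmorph0 rmorph1 divr1; ring].
have EZ : E m%:~R (t ^ m).
  rewrite /exprz; case: m => i; first exact: EX.
  rewrite NegzE mulrNz; apply: (EV _ _ (1 * i.+1%:Z)); last exact: EX.
  exact/hvalX/hval_t.
move=> [f f0 ->].
have vf : hval (to_laurent f) 0 by exists f; rewrite ?expr0z ?mul1r.
have Ef : E 0 (to_laurent f).
  exists ((sg s (to_laurent f) - to_laurent f) / to_laurent f).
    apply: vgeM0; first exact: sgB_fps.
    by have := hval_vge (hvalV vf); rewrite oppr0.
  by rewrite rmorph0 mul0r addr0 mulrBl divff ?(hval_neq0 vf) // addrC subrK.
have [r rE ->] := EM _ _ _ _ EZ Ef.
by rewrite addr0 -addrA -opprD [1 + _ + r]addrC addrK.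
Qed.

Lemma sgB_vge x m : vge m x -> vge (m + b) (sg s x - x).
Proof.
move=> xm; have [->|x0] := eqVneq x 0; first by rewrite rmorph0 subrr; apply: vge0.
have [n le_mn xn] := hval_of_vge xm x0; have := sg_ratio xn.
set r := (X in vge _ X) => rE.
have -> : sg s x - x = x * (r + cst n%:~R * eps) by rewrite /r subrK mulrBr mulrCA divff // !mulr1.
apply: (@vge_le _ (n + b)); first by lia.
apply: vgeM; first exact: hval_vge.
apply: vgeD; first by apply: vge_le rE; lia.
by rewrite mulrC; apply: vgeM0; [apply: vge_eps|apply: vge_cst].
Qed.

(** By [sg_ratio], [s x / x - 1] is [m * eps] to first order, and [eps] has order exactly [b]; the
    order is therefore attained once [m] is nonzero in [k]. *)
Lemma sgB_hval x m : hval (sg s t - t) (b + 1) -> m%:~R != 0 :> k ->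
  hval x m -> hval (sg s x - x) (m + b).
Proof.
move=> vs m0 xm; have x0 := hval_neq0 xm; have := sg_ratio xm.
set r := (X in vge _ X) => rE.
have -> : sg s x - x = x * (cst m%:~R * eps + r) by rewrite [_ + r]addrC /r subrK mulrBr mulrCA divff // !mulr1.
apply: hvalM => //; apply: hvalD => //; rewrite -[b]add0r; apply: hvalM.
  exact: hval_cst.
have -> : eps = (sg s t - t) / t by rewrite mulrBl divff ?t_neq0.
rewrite -[X in hval _ X](addrK 1 b); apply: hvalM => //.
exact/hvalV/hval_t.
Qed.

End Depth.

Definition dsg s x := sg s x - x.

(** This is (X - 1)^p = X^p - 1 evaluated at the [k]-linear operator [sg s]. *)
Lemma iter_dsg_pchar p s x : p \in [pchar k] ->
  iter p (dsg s) x = iter p (sg s) x - x.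
Proof.
(* [phi n q] applies the operator q(sigma) to [x], using the first [n] coefficients of [q]. *)
move=> pk; pose phi (n : nat) (q : {poly k}) := \sum_(i < n) cst q`_i * iter i (sg s) x.
have phiX (n : nat) (q : {poly k}) : phi n.+1 (q * 'X) = sg s (phi n q).
  rewrite /phi big_ord_recl coefMX rmorph0 mul0r add0r rmorph_sum /=.
  by apply: eq_bigr => i _; rewrite coefMX rmorphM /= sg_cst.
have phiB (n : nat) (q r : {poly k}) : phi n (q - r) = phi n q - phi n r.
  rewrite /phi -sumrB; apply: eq_bigr => i _.
  by rewrite coefB rmorphB mulrBl.
have phiW (n : nat) (q : {poly k}) : (size q <= n)%N -> phi n.+1 q = phi n q.
  by move=> le_qn; rewrite /phi big_ord_recr /= nth_default // rmorph0 mul0r addr0.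
have iterE (n : nat) : iter n (dsg s) x = phi n.+1 (('X - 1%:P) ^+ n).
  elim: n => [|n IHn].
    by rewrite /phi big_ord1 expr0 coef1 rmorph1 mul1r.
  rewrite iterS IHn exprSr mulrBr polyC1 mulr1 phiB phiX /dsg.
    by rewrite -polyC1 [phi n.+2 _]phiW // size_exp_XsubC.
rewrite iterE; have pP : p \in [pchar {poly k}] by rewrite (rmorph_pchar polyC).
have := pFrobenius_autB_comm pP (mulrC 'X 1%:P); rewrite !pFrobenius_autE => ->.
rewrite polyC1 expr1n phiB; congr (_ - _).
  rewrite /phi (bigD1 ord_max) //= coefXn eqxx rmorph1 mul1r big1 ?addr0 // => i.
  by rewrite -val_eqE /= coefXn => /negPf ->; rewrite rmorph0 mul0r.
rewrite /phi big_ord_recl big1 ?coef1 ?addr0 ?rmorph1 ?mul1r // => i _.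
by rewrite coef1 /= rmorph0 mul0r.
Qed.

End Automorphisms.

(** * The lower bound on the ramification break *)

Section Ramification.
Variables (k : fieldType) (p : nat).
Hypothesis pcharkp : p \in [pchar k].
Local Notation K := (laurent k).
Local Notation t := (laurent_t k).
Implicit Types (x y z : K) (f g : fps k) (m n : int) (s r u : fps_aut k).

Let p_prime : prime p := pcharf_prime pcharkp.

Lemma intr_pchar_eq0 m : (m%:~R == 0 :> k) = (p %| m)%Z.
Proof.
case: m => i; first by rewrite -[LHS](dvdn_pcharf pcharkp).
by rewrite NegzE mulrNz oppr_eq0 -[LHS](dvdn_pcharf pcharkp) dvdzE.
Qed.

(* A ramification break of a nontrivial automorphism fixes valuations mod p:
   an element moved by [r] of valuation prime to p would be moved at a definite order. *)
Lemma fixed_hval r b x m : 1 <= b -> hval (sg r t - t) (b + 1) ->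
  sg r x = x -> hval x m -> (p %| m)%Z.
Proof.
move=> b1 rb rx xm; rewrite -intr_pchar_eq0; apply/negPn/negP => m0.
have /hval_neq0 := sgB_hval b1 (hval_vge rb) rb m0 xm.
by rewrite rx subrr eqxx.
Qed.

(** Valuations of elements fixed by [r] lie in pZ, so a bound just above [p * n] rises to the next
    multiple. *)
Lemma fixed_vge r b x n : 1 <= b -> hval (sg r t - t) (b + 1) ->
  sg r x = x -> vge (p%:Z * n + 1) x -> vge (p%:Z * (n + 1)) x.
Proof.
move=> b1 rb rx xn; have [->|x0] := eqVneq x 0; first exact: vge0.
have [m le_m xm] := hval_of_vge xn x0; apply: vge_le (hval_vge xm).
have /dvdzP[q mE] := fixed_hval b1 rb rx xm.
have p0 : 0 < p%:Z by have := prime_gt0 p_prime; lia.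
have : p%:Z * n < p%:Z * q by lia.
by rewrite ltr_pM2l // mE [q * _]mulrC ler_pM2l // lezD1.
Qed.

Lemma sgC_dsg r s x : (forall y, sg r (sg s y) = sg s (sg r y)) ->
  sg r (dsg s x) = dsg s (sg r x).
Proof. by move=> rs; rewrite /dsg rmorphB /= rs. Qed.

(** As long as the current order is prime to [p], applying r - 1 raises it by exactly [b]. *)
Lemma iter_dsg_hval r b x m (j : nat) : 1 <= b -> hval (sg r t - t) (b + 1) ->
  hval x m -> (forall i : nat, (i < j)%N -> ~~ (p %| m + b * i%:Z)%Z) ->
  hval (iter j (dsg r) x) (m + b * j%:Z).
Proof.
move=> b1 rb xm; elim: j => [|j IHj] ndiv; first by rewrite mulr0 addr0.
have -> : m + b * j.+1%:Z = m + b * j%:Z + b by lia.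
apply: sgB_hval => //; first exact: hval_vge.
  by rewrite intr_pchar_eq0; apply: ndiv.
by apply: IHj => i lt_ij; apply: ndiv; apply: ltnW.
Qed.

(** Iterating r - 1 on t^b yields elements of orders b, 2b, up to pb; the quotient of the last two
    is the required [z]. *)
Lemma additive_hilbert90 r b : 1 <= b -> hval (sg r t - t) (b + 1) ->
  (forall x, iter p (sg r) x = x) -> exists2 z, hval z (- b) & sg r z - z = 1.
Proof.
move=> b1 rb rp; have Dp x : iter p (dsg r) x = 0 by rewrite iter_dsg_pchar // rp subrr.
have p1 := prime_gt1 p_prime.
have ndvd1 : ~~ (p %| 1)%Z by rewrite dvdzE dvdn1; lia.
(* Otherwise all the orders [1 + b * i] are prime to [p], and (r - 1)^p t has a finite order
   although it is zero. *)
have nb : ~~ (p %| b)%Z.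
  apply/negP => pb; have : hval (iter p (dsg r) t) (1 + b * p%:Z).
    apply: iter_dsg_hval => //; first exact: hval_t.
    by move=> i _; rewrite rpredDr ?dvdz_mulr.
  by rewrite Dp => /hval_neq0; rewrite eqxx.
have hb : hval (t ^+ `|b|%N) b.
  have -> : b = 1 * `|b|%N%:Z by lia.
  rewrite [X in hval (t ^+ X) _](_ : _ = `|b|%N); last by lia.
  exact/hvalX/hval_t.
have hj (j : nat) : (j < p)%N -> hval (iter j (dsg r) (t ^+ `|b|%N)) (b * j.+1%:Z).
  move=> lt_jp; have -> : b * j.+1%:Z = b + b * j%:Z by lia.
  apply: iter_dsg_hval => // i lt_ij.
  have -> : b + b * i%:Z = b * i.+1%:Z by lia.
  rewrite dvdzE abszM Euclid_dvdM // negb_or -dvdzE nb /=.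
  by apply/negP => /dvdn_leq; lia.
(* [g] is fixed by [r] because (r - 1)^p = 0, and [g] is (r - 1) [h]; hence r - 1 maps [h / g] to
   1. *)
set g := iter p.-1 (dsg r) (t ^+ `|b|%N); set h := iter p.-2 (dsg r) (t ^+ `|b|%N).
have gE : g = sg r h - h by rewrite /g (_ : p.-1 = p.-2.+1) ?iterS //; lia.
have rg : sg r g = g.
  apply/eqP; rewrite -subr_eq0; apply/eqP; rewrite -[RHS](Dp (t ^+ `|b|%N)).
  by rewrite -[in RHS](prednK (ltnW p1)) iterS.
have hg : hval g (b * p.-1.+1%:Z) by apply: hj; lia.
have hh : hval h (b * p.-2.+1%:Z) by apply: hj; lia.
exists (h / g).
  have -> : - b = b * p.-2.+1%:Z - b * p.-1.+1%:Z.
    by rewrite -mulrBr (_ : _ - _ = -1) ?mulrN1 //; lia.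
  by apply: hvalM => //; apply: hvalV.
by rewrite fmorph_div /= rg -mulrBl -gE divff // (hval_neq0 hg).
Qed.

(* With [r = s ^ p] and [r z = z + 1], the element [h = s z - z] is fixed by r,
   so its valuation is a multiple of p, as are those of its successive
   differences, while [(s - 1) ^ (p - 1)] maps it to 1. *)
Lemma break_lower_bound s r b0 b :
  1 <= b0 -> vge (b0 + 1) (sg s t - t) ->
  1 <= b -> hval (sg r t - t) (b + 1) ->
  (forall x, sg r x = iter p (sg s) x) -> (forall x, iter p (sg r) x = x) ->
  p%:Z * (p%:Z - 1) + b0 <= b.
Proof.
move=> b01 sb0 b1 rb rE rp.
have p1 := prime_gt1 p_prime.
have [z zb rz] := additive_hilbert90 b1 rb rp.
have rs y : sg r (sg s y) = sg s (sg r y) by rewrite !rE -iterSr.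
pose H j := iter j (dsg s) (dsg s z).
have rH j : sg r (H j) = H j.
  elim: j => [|j IHj]; last by rewrite /H iterS sgC_dsg // IHj.
  have rz1 : sg r z = 1 + z by rewrite -rz subrK.
  by rewrite /H /= /dsg rmorphB /= rs rz1 rmorphD rmorph1 /= opprD addrACA subrr add0r.
have Hp : H p.-1 = 1.
  by rewrite /H -iterSr prednK ?(ltnW p1) // iter_dsg_pchar // -rE rz.
have hb : vge (b0 - b) (H 0%N).
  by rewrite addrC; apply: sgB_vge => //; apply: hval_vge.
have H0 : H 0%N != 0.
  apply/eqP => H0; have /eqP : H p.-1 = 0; last by rewrite Hp oner_eq0.
  by rewrite /H [dsg s z]H0; elim: (p.-1) => //= j ->; rewrite /dsg rmorph0 subrr.
have [m le_m Hm] := hval_of_vge hb H0.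
have /dvdzP[q mE] := fixed_hval b1 rb (rH 0%N) Hm.
(* Each difference raises the order by at least [b0 >= 1], and [fixed_vge] rounds this up to the
   next multiple of [p]. *)
have Hj (j : nat) : vge (p%:Z * (q + j%:Z)) (H j).
  elim: j => [|j IHj]; first by rewrite addr0 mulrC -mE; apply: hval_vge.
  have -> : q + j.+1%:Z = q + j%:Z + 1 by lia.
  apply: (fixed_vge b1 rb); first exact: rH.
  apply: vge_le (sgB_vge b01 sb0 IHj); lia.
(* At [j = p - 1] the element is 1, of order 0, which bounds [q] from above. *)
have := hval_vge_le (hval1 k) (_ : vge _ 1); rewrite -{1}Hp => /(_ _ (Hj p.-1)).
have -> : q + p.-1%:Z = q + (p%:Z - 1) by lia.
rewrite mulrDr [p%:Z * q]mulrC -mE; lia.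
Qed.

(** The coefficient of [t] in [s t] is multiplicative under iteration, so its p^i-th power is 1; in
    characteristic [p] it is then 1 itself. *)
Lemma pow_order_break s i : has_order s (p ^ i)%N -> vge 2 (sg s t - t).
Proof.
move=> [_ si _]; have [f f0 fE] := aut_t s.
have sfE : sg s t = cst (f 0%N) * t + (to_laurent (f - (f 0%N)%:A)) * t.
  rewrite -mulrDl /cst -rmorphD addrC subrK sg_fps fE rmorphM mulrC //.
have vf : vge 1 (to_laurent (f - (f 0%N)%:A)).
  have [g gE] := fps_split (f - (f 0%N)%:A); rewrite gE.
  rewrite coef_fpsD coef_fpsN coef_fpsA subrr scale0r add0r rmorphM.
  by exists g; rewrite expr1z.
have iE (j : nat) : vge 2 (iter j (sg s) t - cst (f 0%N) ^+ j * t).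
  elim: j => [|j IHj]; first by rewrite expr0 mul1r subrr; apply: vge0.
  have -> : iter j.+1 (sg s) t - cst (f 0%N) ^+ j.+1 * t =
    sg s (iter j (sg s) t - cst (f 0%N) ^+ j * t)
     + cst (f 0%N) ^+ j * (sg s t - cst (f 0%N) * t).
    by rewrite iterS rmorphB rmorphM rmorphXn /= sg_cst exprS; ring.
  apply: vgeD; first exact: vge_sg.
  rewrite mulrC; apply: vgeM0; last by rewrite -rmorphXn; apply: vge_cst.
  rewrite sfE addrC addKr; rewrite (_ : 2 = 1 + 1) //; apply: vgeM => //.
  exact/hval_vge/hval_t.
have := iE (p ^ i)%N; rewrite -sgX si sg1 -{1}[t]mul1r -mulrBl.
rewrite -(rmorph1 (@cst k)) -rmorphXn -rmorphB => h2.
have f1 : (f 0%N) = 1.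
  apply/eqP; rewrite -subr_eq0; have : 1 - f 0%N ^+ (p ^ i)%N = 0.
    apply: vge1_cst.
    have := vgeM h2 (hval_vge (hvalV (hval_t k))).
    by rewrite mulfK ?t_neq0 //; apply: vge_le.
  move/eqP; rewrite -oppr_eq0 opprB.
  elim: (i) => [|j IHj]; first by rewrite expn0 expr1.
  rewrite expnSr exprM -[X in _ - X](expr1n _ p).
  have := pFrobenius_autB_comm pcharkp (mulrC (f 0%N ^+ (p ^ j)) 1).
  rewrite !pFrobenius_autE => <-; rewrite expf_eq0 => /andP[_]; exact: IHj.
rewrite sfE f1 rmorph1 mul1r [t + _]addrC addrK; rewrite f1 in vf.
by rewrite (_ : 2 = 1 + 1) //; apply: vgeM => //; exact/hval_vge/hval_t.
Qed.

End Ramification.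

(** * Polynomial relations *)

Section Evaluation.
Variable k : fieldType.
Local Notation K := (laurent k).
Local Notation t := (laurent_t k).
Implicit Types (x y z : K) (m n : int) (P Q : {poly k}).

Definition ev x P : K := (map_poly (@cst k) P).[x].
HB.instance Definition _ x :=
  GRing.RMorphism.copy (ev x) (horner_eval x \o map_poly (@cst k)).

Lemma evC x c : ev x c%:P = cst c.
Proof. by rewrite /ev map_polyC hornerC. Qed.

Lemma evX x : ev x 'X = x.
Proof. by rewrite /ev map_polyX hornerX. Qed.

Lemma ev_MXaddC x P c : ev x (P * 'X + c%:P) = ev x P * x + cst c.
Proof. by rewrite rmorphD rmorphM /= evC evX. Qed.

Lemma sg_ev s x P : sg s (ev x P) = ev (sg s x) P.
Proof.
elim/poly_ind: P => [|P c IHP]; first by rewrite !rmorph0.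
by rewrite !ev_MXaddC rmorphD rmorphM /= sg_cst IHP.
Qed.

Lemma vge_ev x P : vge 0 x -> vge 0 (ev x P).
Proof.
move=> x0; elim/poly_ind: P => [|P c IHP]; first by rewrite rmorph0; apply: vge0.
by rewrite ev_MXaddC; apply: vgeD; [apply: (@vgeM0 _ 0)|apply: vge_cst].
Qed.

(** Positive order kills the constant term, and dividing by [t] lowers order and degree together. *)
Lemma vge_ev_size P : vge (size P) (ev t P) -> P = 0.
Proof.
elim/poly_ind: P => [//|P c IHP].
rewrite size_MXaddC ev_MXaddC; have [P0|P0] /= := eqVneq P 0.
  rewrite P0 rmorph0 mul0r add0r; have [-> _|c0] := eqVneq c 0.
    by rewrite mul0r add0r.
  by rewrite size_poly0 => /vge1_cst/eqP; rewrite (negPf c0).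
move=> vP; have vPt : vge 1 (ev t P * t).
  rewrite mulrC; apply: vgeM0; first exact/hval_vge/hval_t.
  by apply: vge_ev; apply: vge_le (hval_vge (hval_t k)).
have c0 : c = 0.
  apply: vge1_cst; rewrite -[cst c](addKr (ev t P * t)) addrC.
  by apply: vgeB => //; apply: vge_le vP.
move: vP; rewrite c0 rmorph0 addr0 => vP.
suff P00 : P = 0 by rewrite P00 eqxx in P0.
apply: IHP; have := vgeM vP (hval_vge (hvalV (hval_t k))).
by rewrite mulfK ?t_neq0 // intS [1 + _]addrC addrK.
Qed.

Lemma ev_t_eq0 P : (ev t P == 0) = (P == 0).
Proof.
apply/eqP/eqP => [P0|->]; last exact: rmorph0.
by apply: vge_ev_size; rewrite P0; apply: vge0.
Qed.

(** At an element with a pole the leading monomial dominates; in particular such an element is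
    transcendental over [k]. *)
Lemma hval_ev x m P : hval x m -> m < 0 -> P != 0 ->
  hval (ev x P) (m * (size P).-1%:Z).
Proof.
move=> xm m0; elim/poly_ind: P => [|P c IHP]; first by rewrite eqxx.
rewrite size_MXaddC ev_MXaddC; have [P0|P0] /= := eqVneq P 0.
  rewrite P0 rmorph0 !mul0r !add0r; have [->|c0] := eqVneq c 0; first by rewrite eqxx.
  by rewrite size_poly0 mulr0 => _; apply: hval_cst.
move=> _; have := IHP P0 => vP; have sP : (0 < size P)%N by rewrite size_poly_gt0.
have -> : m * (size P)%:Z = m * (size P).-1%:Z + m.
  by rewrite -{1}(prednK sP) intS mulrDr mulr1 addrC.
apply: hvalD; first exact: hvalM.
apply: vge_le (vge_cst c); have : 0 <= (size P).-1%:Z by [].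
by move: (_%:Z) => j; nia.
Qed.

Lemma ev_eq0 x m P : hval x m -> m < 0 -> (ev x P == 0) = (P == 0).
Proof.
move=> xm m0; apply/eqP/eqP => [evP|->]; last exact: rmorph0.
by apply/eqP/negPn/negP => /(hval_ev xm m0)/hval_neq0; rewrite evP eqxx.
Qed.

(** The coefficients are evaluated at [x] and the outer variable at [y], so [size G] controls the
    degree in [y] and [size (swapXY G)] the degree in [x]. *)
Definition ev2 x y (G : {poly {poly k}}) : K := (map_poly (ev x) G).[y].
HB.instance Definition _ x y :=
  GRing.RMorphism.copy (ev2 x y) (horner_eval y \o map_poly (ev x)).

Lemma ev2C x y P : ev2 x y P%:P = ev x P.
Proof. by rewrite /ev2 map_polyC hornerC. Qed.

Lemma ev2X x y : ev2 x y 'X = y.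
Proof. by rewrite /ev2 map_polyX hornerX. Qed.

Lemma ev2Z x y P G : ev2 x y (P *: G) = ev x P * ev2 x y G.
Proof. by rewrite -mul_polyC rmorphM /= ev2C. Qed.

Lemma ev2_swapXY x y G : ev2 x y (swapXY G) = ev2 y x G.
Proof.
elim/poly_ind: G => [|G P IHG]; first by rewrite !rmorph0.
rewrite !(rmorphD, rmorphM) /= swapXY_X swapXY_polyC ev2X !ev2C evX IHG.
congr (_ + _); rewrite /ev2 -map_poly_comp /ev; congr (_.[_]).
by apply: eq_map_poly => c; rewrite /= evC.
Qed.

Lemma sg_ev2 s x y G : sg s (ev2 x y G) = ev2 (sg s x) (sg s y) G.
Proof.
elim/poly_ind: G => [|G P IHG]; first by rewrite !rmorph0.
by rewrite !(rmorphD, rmorphM) /= !ev2X !ev2C sg_ev IHG.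
Qed.

Lemma ev_diag x (G : {poly {poly k}}) : ev x G.['X] = ev2 x x G.
Proof. by rewrite -horner_map /= evX. Qed.

Lemma vge_ev2B x y m G : vge 0 x -> vge 0 y -> vge m (y - x) -> 
  vge m (ev2 x y G - ev2 x x G).
Proof.
move=> x0 y0 xy; have G0 H : vge 0 (ev2 x x H) by rewrite -ev_diag; apply: vge_ev.
elim/poly_ind: G => [|G P IHG]; first by rewrite !rmorph0 subrr; apply: vge0.
rewrite !(rmorphD, rmorphM) /= !ev2X !ev2C.
have -> : ev2 x y G * y + ev x P - (ev2 x x G * x + ev x P) =
  (ev2 x y G - ev2 x x G) * y + (y - x) * ev2 x x G by ring.
by apply: vgeD; apply: vgeM0.
Qed.

Lemma size_diag (G : {poly {poly k}}) a c :
  (size G <= a.+1)%N -> (size (swapXY G) <= c.+1)%N -> (size G.['X] <= (a + c).+1)%N.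
Proof.
move=> sG sG'; rewrite horner_coef; apply: leq_trans (size_sum _ _ _) _.
apply/bigmax_leqP => i _; apply: leq_trans (size_polyMleq _ _) _.
rewrite size_polyXn; have := max_size_coefXY G i; rewrite sizeYE => h.
rewrite addnS /= [in X in (_ <= X)%N]addnC -addSn leq_add ?(leq_trans h) //.
by rewrite -ltnS (leq_trans (ltn_ord i)).
Qed.

(** By the factor theorem the outer minus the inner variable divides [G]; both partial degrees drop
    by one, except when [H] is zero. *)
Lemma diag_eq0 (G : {poly {poly k}}) : G.['X] = 0 -> exists H : {poly {poly k}}, [/\ G = H * ('X - 'X%:P),
  size G = (size H + (H != 0%R))%N & size (swapXY G) = (size (swapXY H) + (H != 0%R))%N ].
Proof.
move=> /eqP/factor_theorem[H ->]; exists H; split=> //.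
  have [->|H0] := eqVneq H 0; first by rewrite mul0r size_poly0.
  by rewrite size_Mmonic ?monicXsubC // size_XsubC addn2 addn1.
have [->|H0] := eqVneq H 0; first by rewrite mul0r rmorph0 size_poly0.
rewrite rmorphM rmorphB /= swapXY_X swapXY_Y -[_ - 'X]opprB mulrN size_polyN.
rewrite size_Mmonic ?monicXsubC ?swapXY_eq0 //.
by rewrite size_XsubC addn2 addn1.
Qed.

(* If the relation vanishes on the diagonal it is divisible by S - T. *)
Lemma relation_bound x m (G : {poly {poly k}}) (a c : nat) :
  vge 0 x -> hval (x - t) m -> G != 0 -> ev2 t x G = 0 ->
  (size G <= a.+1)%N -> (size (swapXY G) <= c.+1)%N -> m <= a%:Z + c%:Z.
Proof.
move=> x0 xm; elim: a => [|a IHa] in c G *.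
  move=> G0 rG sG sG'; have [D0|D0] := eqVneq G.['X] 0.
    have [H [GE sH _]] := diag_eq0 D0; have H0 : H != 0 by apply: contraNneq G0 => H0; rewrite GE H0 mul0r.
    by move: sH; rewrite H0; have := size_poly_gt0 H; rewrite H0; lia.
  rewrite leNgt; apply/negP => lt_m; case/eqP: D0; apply: vge_ev_size.
  rewrite ev_diag -[X in vge _ X]opprK -[- ev2 _ _ _]add0r -rG; apply/vgeN.
  apply: (@vge_le _ m); first by have := size_diag sG sG'; lia.
  apply: vge_ev2B => //; last exact: hval_vge.
  exact: vge_le (hval_vge (hval_t k)).
move=> G0 rG sG sG'; have [D0|D0] := eqVneq G.['X] 0.
  have [H [GE sH sH']] := diag_eq0 D0; have H0 : H != 0 by apply: contraNneq G0 => H0; rewrite GE H0 mul0r.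
  move: sH sH'; rewrite H0 => sH sH'.
  have := size_poly_gt0 (swapXY H); rewrite swapXY_eq0 H0 => sw0.
  have le_m : m <= a%:Z + c.-1%:Z.
    apply: (IHa _ H) => //.
    - move: rG; rewrite GE rmorphM rmorphB /= ev2X ev2C evX => /eqP.
      by rewrite mulf_eq0 (negPf (hval_neq0 xm)) orbF => /eqP.
    - by move: sG; rewrite sH addn1 ltnS.
    - move: sG'; rewrite sH' addn1 ltnS => h.
      by rewrite prednK // (leq_trans sw0).
  by lia.
(* The value of the diagonal polynomial at [t] is congruent to the relation modulo order [m]; an
   order above the total degree forces that polynomial to be zero. *)
rewrite leNgt; apply/negP => lt_m; case/eqP: D0; apply: vge_ev_size.
rewrite ev_diag -[X in vge _ X]opprK -[- ev2 _ _ _]add0r -rG; apply/vgeN.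
apply: (@vge_le _ m); first by have := size_diag sG sG'; lia.
apply: vge_ev2B => //; last exact: hval_vge.
exact: vge_le (hval_vge (hval_t k)).
Qed.

End Evaluation.

(** * Gauss's lemma and relations of small degree in both variables at once *)

Section Gauss.
Variable k : fieldType.
Implicit Types (c q : {poly k}) (F H : {poly {poly k}}).

Lemma irreducible_factor c :
  (1 < size c)%N -> exists q, irreducible_poly q /\ q %| c.
Proof.
have [n] := ubnP (size c); elim: n c => // n IHn c le_cn c1.
have [irr|nirr] := pselect (irreducible_poly c); first by exists c; split.
have [q [q1 [qc nqc]]] : exists q, size q != 1 /\ (q %| c /\ ~~ (q %= c)).
  apply: contrapT => nq; apply: nirr; split=> // q q1 qc.
  by apply/negPn/negP => nqc; apply: nq; exists q.
have c0 : c != 0 by rewrite -size_poly_gt0; lia.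
have q0 : q != 0 by apply: contraNneq c0 => q0; rewrite -dvd0p -q0.
have lt_qc : (size q < size c)%N.
  by rewrite ltn_neqAle dvdp_leq // andbT dvdp_size_eqp.
have [||r [irr rq]] := IHn q.
- by apply: leq_trans lt_qc _.
- by have := size_poly_gt0 q; rewrite q0; lia.
by exists r; split=> //; apply: dvdp_trans qc.
Qed.

(** Gauss's lemma. If both fail, let [i] and [j] be the first coefficients not divisible by [q]: in
    the coefficient [i + j] of the product a single term is not divisible. *)
Lemma irreducible_dvd_mul q F H : irreducible_poly q ->
  (forall i, q %| (F * H)`_i) -> (forall i, q %| F`_i) \/ (forall i, q %| H`_i).
Proof.
move=> irr qFH; apply: contrapT => /not_orP[/existsNP nF /existsNP nH].
have {}nF : exists i, ~~ (q %| F`_i) by have [i /negP] := nF; exists i.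
have {}nH : exists i, ~~ (q %| H`_i) by have [i /negP] := nH; exists i.
case: (ex_minnP nF) => i Fi min_i; case: (ex_minnP nH) => j Hj min_j.
have := qFH (i + j)%N; rewrite coefM.
have lt_i : (i < (i + j).+1)%N by lia.
rewrite (bigD1 (Ordinal lt_i)) //= addKn dvdp_addl.
  by rewrite Gauss_dvdpr ?irreducible_poly_coprime // (negPf Hj).
elim/big_ind: _ => [|x y qx qy|l]; [exact: dvdp0|exact: dvdp_add|].
rewrite -val_eqE /= => ne_li; case: (ltngtP l i) ne_li => // [lt_li|lt_il] _.
  by apply/dvdp_mulr/negPn/negP => /min_i; lia.
by apply/dvdp_mull/negPn/negP => /min_j; have := ltn_ord l; lia.
Qed.

Lemma coef_divisible q F : q != 0 -> (forall i, q %| F`_i) -> exists F', F = q *: F'.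
Proof.
move=> q0 qF; exists (\poly_(i < size F) (F`_i %/ q)); apply/polyP => i.
rewrite coefZ coef_poly; case: ltnP => [_|le_i]; first by rewrite mulrC divpK.
by rewrite mulr0 nth_default.
Qed.

Lemma size_swapXYZ c F : c != 0 ->
  size (swapXY (c *: F)) = (size (swapXY F) + (size c).-1 * (F != 0%R))%N.
Proof.
move=> c0; have [->|F0] := eqVneq F 0; first by rewrite scaler0 rmorph0 size_poly0 muln0.
rewrite -mul_polyC rmorphM /= swapXY_polyC size_mul ?swapXY_eq0 //.
  rewrite size_map_polyC muln1.
  by rewrite addnC -subn1 -addnBA ?subn1 // size_poly_gt0.
by rewrite map_polyC_eq0.
Qed.

Lemma scale_poly_inj q : q != 0 -> injective (fun F => q *: F).
Proof.
move=> q0 F H; rewrite -!mul_polyC; apply: mulfI.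
by rewrite polyC_eq0.
Qed.

(** The irreducible factors of [c] are cancelled one by one, each from [H] or from [F]. Once [c] is
    constant, what remains of [F] divides [G] up to a scalar, hence the bound on the inner degree.
    [Z] will be the property of vanishing at a point. *)
Lemma primitive_divisor c F G H (Z : {poly {poly k}} -> Prop) :
  (forall q F, q != 0 -> Z (q *: F) -> Z F) ->
  c != 0 -> F != 0 -> G != 0 -> Z F -> c *: G = H * F ->
  exists F' : {poly {poly k}}, [/\ F' != 0, Z F', size F' = size F & (size (swapXY F') <= size (swapXY G))%N].
Proof.
move=> Zq; have [n] := ubnP (size c).
elim: n c F H => // n IHn c F H le_cn c0 F0 G0 ZF cG.
have [c1|c1] := leqP (size c) 1.
  exists F; split=> //; have := size_swapXYZ G c0; rewrite cG G0 rmorphM /=.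
  have H0 : H != 0.
    apply: contraNneq G0 => H0; have /eqP := cG.
    by rewrite H0 mul0r -mul_polyC mulf_eq0 polyC_eq0 (negPf c0).
  rewrite size_mul ?swapXY_eq0 //.
  have sH : (0 < size (swapXY H))%N by rewrite size_poly_gt0 swapXY_eq0.
  rewrite muln1 (_ : (size c).-1 = 0%N) ?addn0; last by case: (size c) c1 => [|[]].
  by rewrite -(prednK sH) addSn /= => <-; apply: leq_addl.
have [q [irr /dvdpP[c' cE]]] := irreducible_factor c1.
have q0 := irredp_neq0 irr.
have c'0 : c' != 0 by apply: contraNneq c0 => c'0; rewrite cE c'0 mul0r.
have lt_c' : (size c' < n)%N.
  move: le_cn; rewrite cE size_mul // ltnS; apply: leq_trans.
  have := irr.1; case: (size q) => [|[|m]] // _.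
  by rewrite !addnS /= ltnS leq_addr.
have [|qH|qF] := irreducible_dvd_mul (F := H) (H := F) irr.
- by move=> i; rewrite -cG coefZ cE mulrAC dvdp_mull.
- have [H' HE] := coef_divisible q0 qH.
  apply: (IHn c' F H') => //.
  by move: cG; rewrite cE HE mulrC -scalerA -scalerAl; apply: scale_poly_inj.
have [F' FE] := coef_divisible q0 qF.
have F'0 : F' != 0 by apply: contraNneq F0 => F'0; rewrite FE F'0 scaler0.
have cG' : c' *: G = H * F'.
  by apply: (scale_poly_inj q0); rewrite scalerA mulrC -cE cG FE scalerAr.
have ZF' : Z F' by apply: (Zq q) => //; rewrite -FE.
have [F'' [? ? sF ?]] := IHn c' F' H lt_c' c'0 F'0 G0 ZF' cG'.
by exists F''; split=> //; rewrite FE size_scale.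
Qed.

(** A relation of least degree in [y] divides [F2] after multiplication by an element of k[X];
    [primitive_divisor] then makes its degree in [x] at most that of [F2]. *)
Lemma common_relation (x y : laurent k) F1 F2 : (forall q, q != 0 -> ev x q != 0) ->
  F1 != 0 -> ev2 x y F1 = 0 -> F2 != 0 -> ev2 x y F2 = 0 ->
  exists F : {poly {poly k}}, [/\ F != 0, ev2 x y F = 0, (size F <= size F1)%N
                & (size (swapXY F) <= size (swapXY F2))%N].
Proof.
move=> x_trans F10 F1r F20 F2r.
pose P n := `[< exists F : {poly {poly k}}, [/\ F != 0, ev2 x y F = 0 & size F = n] >].
have exP : exists n, P n by exists (size F1); apply/asboolP; exists F1.
case: (ex_minnP exP) => n /asboolP[F [F0 Fr sF]] min_n.
have F2E := Pdiv.Idomain.divp_eq F2 F.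
(* A nonzero remainder would be a relation of smaller degree in [y]. *)
have r0 : F2 %% F = 0.
  apply/eqP/negPn/negP => r0; have := Pdiv.Idomain.ltn_modpN0 F2 F0.
  rewrite ltnNge sF min_n //; apply/asboolP; exists (F2 %% F); split=> //.
  have := congr1 (ev2 x y) F2E; rewrite ev2Z F2r mulr0 rmorphD rmorphM /= Fr mulr0.
  by rewrite add0r.
rewrite r0 addr0 in F2E.
have Zq q H : q != 0 -> ev2 x y (q *: H) = 0 -> ev2 x y H = 0.
  by move=> q0 /eqP; rewrite ev2Z mulf_eq0 (negPf (x_trans _ q0)) => /eqP.
have l0 : lead_coef F ^+ scalp F2 F != 0 by rewrite expf_neq0 ?lead_coef_eq0.
have [F' [F'0 F'r sF' sF'2]] := primitive_divisor Zq l0 F0 F20 Fr F2E.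
exists F'; split=> //; rewrite sF' sF; apply: min_n.
by apply/asboolP; exists F1.
Qed.

End Gauss.

(** * The field generated by the orbit of t *)

Lemma subf_div (F : fieldType) (a b c d : F) : b != 0 -> d != 0 ->
  a / b - c / d = (a * d - c * b) / (b * d).
Proof. by move=> b0 d0; field; rewrite ?b0 ?d0. Qed.

Lemma inverse_from_relation (F : fieldType) (x g a : F) :
  x != 0 -> a != 0 -> g * x + a = 0 -> x^-1 = g * (- 1 / a).
Proof.
move=> x0 a0 /eqP; rewrite addr_eq0 => /eqP gx; apply: (mulIf x0).
by rewrite mulVf // mulrAC gx mulrA mulrN1 opprK divff.
Qed.

Section Adjoin.
Variable k : fieldType.
Local Notation K := (laurent k).
Local Notation t := (laurent_t k).
Implicit Types (x y z : K) (X Y : set K) (P Q : {poly k}).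

Lemma adjoin_min X (A : K -> Prop) :
  (forall c, A (cst c)) -> (forall x, X x -> A x) ->
  (forall x y, A x -> A y -> A (x - y)) -> (forall x y, A x -> A y -> A (x / y)) ->
  forall x, adjoin X x -> A x.
Proof.
move=> Ac AX AB AV x; apply: (smallest_sub (X := A)).
  split=> [|y z|y z]; rewrite ?inE /=; first by have := Ac 1; rewrite rmorph1.
    exact: AB.
  exact: AV.
by move=> y [[c _ <-]|]; [exact: Ac|exact: AX].
Qed.

Lemma adjoin_closed X : divring_closed [in adjoin X].
Proof.
split=> [|x y|x y]; rewrite ?inE /=.
- by move=> A [[A1 _ _] _]; rewrite inE in A1.
- move=> Xx Xy A AX; have [[_ AB _] _] := AX.
  by have := AB x y; rewrite !inE; apply; [apply: Xx|apply: Xy].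
- move=> Xx Xy A AX; have [[_ _ AV] _] := AX.
  by have := AV x y; rewrite !inE; apply; [apply: Xx|apply: Xy].
Qed.

Lemma adjoin_gen X x : X x -> adjoin X x.
Proof. by move=> Xx; apply: sub_gen_smallest; right. Qed.

Lemma adjoin_cst X c : adjoin X (cst c).
Proof. by apply: sub_gen_smallest; left; exists c. Qed.

Lemma adjoinB X x y : adjoin X x -> adjoin X y -> adjoin X (x - y).
Proof. by have [_ B _] := adjoin_closed X; have := B x y; rewrite !inE. Qed.

Lemma adjoin_div X x y : adjoin X x -> adjoin X y -> adjoin X (x / y).
Proof. by have [_ _ V] := adjoin_closed X; have := V x y; rewrite !inE. Qed.

Lemma adjoin1 X : adjoin X 1.
Proof. by rewrite -(rmorph1 (@cst k)); apply: adjoin_cst. Qed.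

Lemma adjoin0 X : adjoin X 0.
Proof. by rewrite -(rmorph0 (@cst k)); apply: adjoin_cst. Qed.

Lemma adjoinD X x y : adjoin X x -> adjoin X y -> adjoin X (x + y).
Proof.
move=> Xx Xy; rewrite -[y]opprK; apply: adjoinB => //.
by rewrite -[- y]add0r; apply: adjoinB => //; apply: adjoin0.
Qed.

Lemma adjoinM X x y : adjoin X x -> adjoin X y -> adjoin X (x * y).
Proof.
move=> Xx Xy; rewrite -[y]invrK; apply: adjoin_div => //.
by rewrite -[_^-1]mul1r; apply: adjoin_div => //; apply: adjoin1.
Qed.

Lemma adjoinX X x i : adjoin X x -> adjoin X (x ^+ i).
Proof.
move=> Xx; elim: i => [|i IH]; first exact: adjoin1.
by rewrite exprS; apply: adjoinM.
Qed.

Lemma adjoin_sub X Y x :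
  (forall y, X y -> adjoin Y y) -> adjoin X x -> adjoin Y x.
Proof.
move=> XY; move: x; apply: adjoin_min => //; [exact: adjoin_cst|exact: adjoinB|exact: adjoin_div].
Qed.

Lemma adjoin_sg X Y s x :
  (forall y, X y -> adjoin Y (sg s y)) -> adjoin X x -> adjoin Y (sg s x).
Proof.
move=> XY; move: x; apply: adjoin_min => //.
- by move=> c; rewrite sg_cst; apply: adjoin_cst.
- by move=> y z; rewrite rmorphB; apply: adjoinB.
- by move=> y z; rewrite fmorph_div; apply: adjoin_div.
Qed.

Lemma adjoin_ev X x P : adjoin X x -> adjoin X (ev x P).
Proof.
move=> Xx; elim/poly_ind: P => [|P c IHP]; first by rewrite rmorph0; apply: adjoin0.
by rewrite ev_MXaddC; apply: adjoinD; [apply: adjoinM|apply: adjoin_cst].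
Qed.

Lemma adjoin1P x y : adjoin [set x]%classic y ->
  exists P Q, ev x Q != 0 /\ y = ev x P / ev x Q.
Proof.
move: y; apply: adjoin_min => [c|_ ->|_ _ [P [Q [Q0 ->]]] [P' [Q' [Q0' ->]]]|
    _ _ [P [Q [Q0 ->]]] [P' [Q' [Q0' ->]]]].
- by exists c%:P, 1; rewrite rmorph1 oner_eq0 evC divr1.
- by exists 'X, 1; rewrite rmorph1 oner_eq0 evX divr1.
- exists (P * Q' - P' * Q), (Q * Q'); rewrite (rmorphB (ev x)) !(rmorphM (ev x)) /=.
  by split; [exact: mulf_neq0|exact: subf_div].
have [P'0|P'0] := eqVneq (ev x P') 0.
  (* The divisor is zero here, so the quotient is 0 by convention. *)
  by exists 0, 1; rewrite rmorph1 oner_eq0 P'0 mul0r invr0 mulr0 rmorph0 mul0r.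
exists (P * Q'), (Q * P'); rewrite !(rmorphM (ev x)) /=.
by split; [apply: mulf_neq0|rewrite invf_div mulf_div].
Qed.

End Adjoin.

Lemma poly_split (R : nzRingType) (F : {poly R}) :
  exists G, F = G * 'X + (F`_0)%:P /\ (size G <= (size F).-1)%N.
Proof.
exists (\poly_(i < (size F).-1) F`_i.+1); split.
  apply/polyP => -[|i]; rewrite coefD coefMX coefC ?add0r // addr0 coef_poly.
  by case: ltnP => // le_i; rewrite nth_default //; move: le_i; case: (size F).
exact: size_poly.
Qed.

(** * Elements of k(t, beta) have degree at most p over k(t) *)

Section ArtinSchreierDegree.
Variables (k : fieldType) (q : nat).
Local Notation p := q.+2.
Local Notation K := (laurent k).
Local Notation t := (laurent_t k).
Variable beta : K.
Hypothesis wp_beta : adjoin [set t]%classic (wp p beta).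
Implicit Types (x y z : K) (P Q D : {poly k}).

Local Notation v := (\row_(i < p) beta ^+ i).

(* [x] acts on the span of 1, beta, .., beta^(p-1) over k(t) through the matrix M / d. *)
Definition finite_action x : Prop :=
  exists d, d != 0 /\ exists M : 'M[{poly k}]_p,
    v *m map_mx (ev t) M = (ev t d * x) *: v.

Lemma finite_actionP x d : d != 0 ->
  (forall j : 'I_p, exists c : 'I_p -> {poly k},
     ev t d * x * beta ^+ j = \sum_(i < p) beta ^+ i * ev t (c i)) ->
  finite_action x.
Proof.
move=> d0 /choice[c cE]; exists d; split=> //; exists (\matrix_(i, j) c j i).
apply/rowP => j; rewrite !mxE cE; apply: eq_bigr => i _.
by rewrite !mxE.
Qed.

Lemma finite_action_ratio P D : D != 0 -> finite_action (ev t P / ev t D).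
Proof.
move=> D0; exists D; split=> //; exists P%:M.
by rewrite map_scalar_mx mul_mx_scalar mulrCA divff ?ev_t_eq0 // mulr1.
Qed.

Lemma finite_actionB x y : finite_action x -> finite_action y -> finite_action (x - y).
Proof.
move=> [d [d0 [M ME]]] [e [e0 [N NE]]]; exists (d * e); split; first by rewrite mulf_neq0.
exists (e *: M - d *: N).
rewrite map_mxB !map_mxZ mulmxBr -!scalemxAr ME NE !scalerA -scalerBl rmorphM /=.
by congr (_ *: _); ring.
Qed.

Lemma finite_actionM x y : finite_action x -> finite_action y -> finite_action (x * y).
Proof.
move=> [d [d0 [M ME]]] [e [e0 [N NE]]]; exists (d * e); split; first by rewrite mulf_neq0.
exists (M *m N).
rewrite map_mxM mulmxA ME -scalemxAl NE scalerA rmorphM /=.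
by congr (_ *: _); ring.
Qed.

Lemma finite_actionD x y : finite_action x -> finite_action y -> finite_action (x + y).
Proof.
move=> Ax Ay; rewrite -[y]opprK; apply: finite_actionB => //.
rewrite -[- y]add0r; apply: finite_actionB => //.
by rewrite -(subrr y); apply: finite_actionB.
Qed.

(** The matrix is the companion matrix of beta^p = beta + P/D, cleared of its denominator [D]. *)
Lemma finite_action_beta : finite_action beta.
Proof.
have [P [D [D0 wpE]]] := adjoin1P wp_beta.
have bp : ev t D * beta ^+ p = ev t D * beta + ev t P.
  move: wpE; rewrite /wp => /eqP; rewrite subr_eq => /eqP ->.
  by rewrite mulrDr addrC mulrCA divff // mulr1.
rewrite ev_t_eq0 in D0; apply: (finite_actionP D0) => j.
rewrite -mulrA -exprS; have [lt_jp|le_pj] := ltnP j.+1 p.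
  exists (fun i => if i == Ordinal lt_jp then D else 0).
  rewrite (bigD1 (Ordinal lt_jp)) //= eqxx mulrC big1 ?addr0 // => i /negPf ->.
  by rewrite rmorph0 mulr0.
have -> : j.+1 = p by apply/eqP; rewrite eqn_leq le_pj ltn_ord.
exists (fun i : 'I_p => if i == 0%N :> nat then P else if i == 1%N :> nat then D else 0).
rewrite !big_ord_recl big1 /= => [|i _]; last by rewrite rmorph0 mulr0.
by rewrite bp addr0 mul1r /bump /= expr1 addrC mulrC.
Qed.

(** The row [v] is nonzero, its first entry being 1, so it is an eigenvector of [M] for [d * x].
    Composing the characteristic polynomial with [d *: 'X] gives a relation for [x]. *)
Lemma finite_action_algebraic x : finite_action x ->
  exists F : {poly {poly k}}, [/\ F != 0, ev2 t x F = 0 & (size F <= p.+1)%N].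
Proof.
move=> [d [d0 [M ME]]]; exists (char_poly M \Po (d *: 'X)).
have sdX : size (d *: 'X) = 2%N by rewrite size_scale // size_polyX.
have sF : size (char_poly M \Po (d *: 'X)) = p.+1.
  have := size_comp_poly (char_poly M) (d *: 'X).
  rewrite sdX size_char_poly muln1 /=.
  by case: (size (char_poly M \Po _)) => //= n ->.
split; [by rewrite -size_poly_gt0 sF| |by rewrite sF].
rewrite /ev2 map_comp_poly horner_comp map_polyZ map_polyX hornerZ hornerX /=.
rewrite map_char_poly; apply/eqP; rewrite -[_ == 0]/(root _ _) -eigenvalue_root_char.
apply/eigenvalueP; exists v; first exact: ME.
apply/eqP => /rowP/(_ 0); rewrite !mxE expr0; apply/eqP; exact: oner_neq0.
Qed.

(** A relation for [x] with nonzero constant term expresses the inverse as a polynomial in [x] over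
    k(t). *)
Lemma finite_actionV x : finite_action x -> finite_action x^-1.
Proof.
move=> Ax; have [->|x0] := eqVneq x 0.
  by rewrite invr0 -(subrr x); apply: finite_actionB.
have Ac P D : D != 0 -> finite_action (ev t P / ev t D) by exact: finite_action_ratio.
have AP P : finite_action (ev t P).
  by rewrite -[ev t P]divr1 -(rmorph1 (ev t)); apply: Ac; rewrite oner_eq0.
have [F [F0 Fx _]] := finite_action_algebraic Ax.
(* Powers of the outer variable are divided out, which is allowed because [x] is nonzero. *)
have {F F0 Fx} [F [Fx F0]] : exists F, ev2 t x F = 0 /\ F`_0 != 0.
  have [n] := ubnP (size F); elim: n F F0 Fx => // n IHn F F0 Fx le_Fn.
  have [F00|F00] := eqVneq F`_0 0; last by exists F.
  have [G [FE sG]] := poly_split F; rewrite F00 addr0 in FE.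
  apply: (IHn G).
  - by apply: contraNneq F0 => H0; rewrite FE H0 mul0r.
  - by move: Fx; rewrite FE rmorphM /= ev2X => /eqP; rewrite mulf_eq0 (negPf x0) orbF => /eqP.
  - apply: leq_ltn_trans sG _; move: le_Fn.
    by have := size_poly_gt0 F; rewrite F0; case: (size F).
have AF (G : {poly {poly k}}) : finite_action (ev2 t x G).
  elim/poly_ind: G => [|G P IHG]; first by have := AP 0; rewrite !rmorph0.
  by rewrite rmorphD rmorphM /= ev2X ev2C; apply: finite_actionD => //; apply: finite_actionM.
have [G [GE _]] := poly_split F.
have xG : ev2 t x G * x + ev t F`_0 = 0.
  by rewrite -[RHS]Fx [in RHS]GE (rmorphD (ev2 t x)) (rmorphM (ev2 t x)) /= ev2X ev2C.
have a0 : ev t F`_0 != 0 by rewrite ev_t_eq0.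
have -> : x^-1 = ev2 t x G * (ev t (- 1) / ev t F`_0).
  rewrite (rmorphN (ev t)) (rmorph1 (ev t)); exact: inverse_from_relation.
by apply: finite_actionM; [exact: AF|exact: Ac].
Qed.

Lemma finite_action_adjoin x : adjoin [set t; beta]%classic x -> finite_action x.
Proof.
move: x; apply: adjoin_min => [c|y [->|->]|y z|y z Ay Az].
- by rewrite -(evC t) -[ev _ _]divr1 -(rmorph1 (ev t)); apply: finite_action_ratio; rewrite oner_eq0.
- by rewrite -{1}(evX t) -[ev _ _]divr1 -(rmorph1 (ev t)); apply: finite_action_ratio; rewrite oner_eq0.
- exact: finite_action_beta.
- exact: finite_actionB.
- by apply: finite_actionM => //; apply: finite_actionV.
Qed.

(** The first entry of the row of powers is 1, so the first column of the matrix holds the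
    coordinates of [d * x]. *)
Lemma adjoin_beta_span x : adjoin [set t; beta]%classic x ->
  exists c : 'I_p -> K, (forall i, adjoin [set t]%classic (c i)) /\
    x = \sum_(i < p) c i * beta ^+ i.
Proof.
move=> /finite_action_adjoin[d [d0 [M /rowP/(_ 0)]]]; rewrite !mxE mulr1 => ME.
exists (fun i => ev t (M i 0) / ev t d); split=> [i|].
  by apply: adjoin_div; apply: adjoin_ev; apply: adjoin_gen.
apply: (mulfI (x := ev t d)); first by rewrite ev_t_eq0.
rewrite -ME mulr_sumr; apply: eq_bigr => i _; rewrite !mxE.
by rewrite mulrA [ev t d * _]mulrCA divff ?ev_t_eq0 // mulr1 mulrC.
Qed.

End ArtinSchreierDegree.

Section SubgroupGen.
Variable G : groupType.
Implicit Types s u : G.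

Lemma subgroup_gen_closed s : group_closed [in subgroup_gen s].
Proof.
split=> [|x y]; rewrite ?inE /=.
  by move=> A [[A1 _] _]; rewrite inE in A1.
move=> Gx Gy A AX; have [[_ AV] _] := AX.
by have := AV x y; rewrite !inE; apply; [apply: Gx|apply: Gy].
Qed.

Lemma subgroup_gen_id s : subgroup_gen s s.
Proof. by apply: sub_gen_smallest. Qed.

Lemma subgroup_genV s u : subgroup_gen s u -> subgroup_gen s u^-1%g.
Proof.
by move=> Gu; have := group_closedV (subgroup_gen_closed s) (x := u); rewrite !inE; apply.
Qed.

Lemma subgroup_genM s u v :
  subgroup_gen s u -> subgroup_gen s v -> subgroup_gen s (u * v)%g.
Proof.
move=> Gu Gv; have := group_closedM (subgroup_gen_closed s) (x := u) (y := v).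
by rewrite !inE; apply.
Qed.

Lemma subgroup_genX s i : subgroup_gen s (s ^+ i)%g.
Proof.
elim: i => [|i IHi].
  by have [] := subgroup_gen_closed s; rewrite inE expg0.
by rewrite expgS; apply: subgroup_genM => //; apply: subgroup_gen_id.
Qed.

End SubgroupGen.

(** * The upper bound on the break, forcing p = 2 and n = 2 *)

Section OrderAndBreak.
Variable k : fieldType.
Local Notation K := (laurent k).
Local Notation t := (laurent_t k).
Implicit Types (x y z : K) (s r u : fps_aut k).

(** Both automorphisms preserve the valuation, so splitting off constant terms repeatedly shows that
    [s f - u f] has arbitrarily large order. *)
Lemma aut_ext s u : s (fpsX k) = u (fpsX k) -> s = u.
Proof.
move=> su; apply: fps_autP => f; apply: to_laurent_inj; rewrite -!sg_fps.
apply/eqP; rewrite -subr_eq0; apply/eqP/vge_all_eq0 => m.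
apply: (@vge_le _ `|m|%N%:Z); first by lia.
elim: `|m|%N f => [|N IHN] f; first by apply: vgeB; apply/vge_sg/vge_fps.
have [g ->] := fps_split f; rewrite !rmorphD !rmorphM /= -/(cst (f 0%N)) !sg_cst.
have -> : sg s (to_laurent (fpsX k)) = sg u t by rewrite !sg_fps su.
rewrite opprD addrACA subrr add0r -mulrBr intS.
by apply: vgeM; [apply/hval_vge/hval_sg/hval_t|apply: IHN].
Qed.

Lemma aut_ext_sg s u : sg s t = sg u t -> s = u.
Proof. by rewrite !sg_fps => /to_laurent_inj/aut_ext. Qed.

Lemma vge_expg s i (m : int) : vge m (sg s t - t) -> vge m (sg (s ^+ i)%g t - t).
Proof.
move=> sm; elim: i => [|i IHi]; first by rewrite expg0 sg1 subrr; apply: vge0.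
rewrite expgS sgM -(subrK (sg s t) (sg s _)) -rmorphB -addrA.
by apply: vgeD => //; apply: vge_sg.
Qed.

(** Applying [r] to a relation between [t] and its image under the inverse of [r] gives one between
    [r t] and [t] with the variables exchanged; [F1] thus bounds the degree in [r t] and [F2] the
    degree in [t]. *)
Lemma aut_relation r F1 F2 :
  F1 != 0 -> ev2 t (sg r t) F1 = 0 -> F2 != 0 -> ev2 t (sg r^-1%g t) F2 = 0 ->
  exists F : {poly {poly k}}, [/\ F != 0, ev2 t (sg r t) F = 0, (size F <= size F1)%N
              & (size (swapXY F) <= size F2)%N].
Proof.
move=> F10 F1r F20 F2r; rewrite -[F2]swapXYK; apply: common_relation => //.
- by move=> q q0; rewrite ev_t_eq0.
- by rewrite swapXY_eq0.
- have := congr1 (sg r) F2r; rewrite sg_ev2 -sgM mulgV sg1 ev2_swapXY => ->.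
  exact: rmorph0.
Qed.

Lemma break_upper_bound r F1 F2 (m : int) :
  F1 != 0 -> ev2 t (sg r t) F1 = 0 -> F2 != 0 -> ev2 t (sg r^-1%g t) F2 = 0 ->
  hval (sg r t - t) m -> m <= (size F1).-1%:Z + (size F2).-1%:Z.
Proof.
move=> F10 F1r F20 F2r rm.
have [F [F0 Fr sF sF']] := aut_relation F10 F1r F20 F2r.
apply: relation_bound rm F0 Fr _ _; last 2 first.
- by rewrite prednK // size_poly_gt0.
- by rewrite prednK // size_poly_gt0.
by apply: vge_sg; apply: vge_le (hval_vge (hval_t k)).
Qed.

Lemma order_and_break p s n : p \in [pchar k] -> (1 < n)%N ->
  almost_rational p s -> has_order s (p ^ n)%N ->
  [/\ p = 2%N, n = 2%N & hval (sg (s ^+ 2)%g t - t) 4].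
Proof.
move=> pk n1 [_ [beta [wp_beta _ LE]]] sn.
have p1 := prime_gt1 (pcharf_prime pk).
have [q pE] : exists q, p = q.+2 by exists p.-2; lia.
have algL u : subgroup_gen s u ->
    exists F : {poly {poly k}}, [/\ F != 0, ev2 t (sg u t) F = 0 & (size F <= p.+1)%N].
  move=> Gu; have : adjoin [set t; beta]%classic (sg u t).
    by rewrite -LE sg_fps; apply: adjoin_gen; exists u.
  rewrite pE in wp_beta *.
  by move=> /(finite_action_adjoin wp_beta)/finite_action_algebraic.
have s2 := pow_order_break pk sn.
(* [r] has order [p], and [u] is a p-th root of it, available because [n > 1]. *)
pose u := (s ^+ (p ^ (n - 2)))%g; pose r := (u ^+ p)%g.
have rE : r = (s ^+ (p ^ n.-1))%g.
  by rewrite /r /u -expgnA -expnSr; congr (_ ^+ (_ ^ _))%g; lia.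
have [_ sn1 sn2] := sn.
have rp : (r ^+ p)%g = 1%g.
  by rewrite rE -expgnA -expnSr prednK ?(ltnW n1).
have r1 : r <> 1%g.
  rewrite rE; apply: sn2; rewrite expn_gt0 (ltnW p1) /=.
  by rewrite ltn_exp2l // ltn_predL ltnW.
have rt : sg r t - t != 0.
  by rewrite subr_eq0; apply/eqP => rt; apply: r1; apply: aut_ext_sg; rewrite sg1.
have r2 : vge 2 (sg r t - t) by rewrite rE; apply: vge_expg.
(* [m] is the valuation of [r t - t], so the break is [m - 1]. *)
have [m m2 rm] := hval_of_vge r2 rt.
have m1 : 1 <= m - 1 by lia.
rewrite -(subrK 1 m) in rm.
have powE (v w : fps_aut k) i x : w = (v ^+ i)%g -> sg w x = iter i (sg v) x.
  by move=> ->; apply: sgX.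
have lower (b : int) : 1 <= b -> vge (b + 1) (sg u t - t) ->
    p%:Z * (p%:Z - 1) + b <= m - 1.
  move=> b1 ub; apply: (break_lower_bound pk b1 ub m1 rm) => x; first exact: powE.
  by rewrite -sgX rp sg1.
have low1 := lower 1 isT (vge_expg _ s2).
have Gr : subgroup_gen s r by rewrite rE; apply: subgroup_genX.
have [F1 [F10 F1r sF1]] := algL _ Gr.
have [F2 [F20 F2r sF2]] := algL _ (subgroup_genV Gr).
have up : m - 1 + 1 <= p%:Z + p%:Z.
  apply: le_trans (break_upper_bound F10 F1r F20 F2r rm) _.
  by move: sF1 sF2; case: (size F1) => [|i]; case: (size F2) => [|j] /=; lia.
(* The two bounds give [p * (p - 1) + 2 <= m <= 2 * p], impossible for [p >= 3]; for [p = 2] they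
   leave only [m = 4]. *)
have p2 : p = 2%N.
  have [//|p3] := leqP p 2; first by lia.
  have : p%:Z * 2 <= p%:Z * (p%:Z - 1) by rewrite ler_pM2l; lia.
  by move: low1 up; lia.
have m4 : m = 4 by move: low1 up; rewrite p2; lia.
have n2 : n = 2%N.
  apply/eqP; rewrite eqn_leq n1 andbT leqNgt; apply/negP => n2.
  (* In characteristic 2, w^2 - 1 = (w - 1)^2, so [u t - t] has order at least 3; the lower bound
     with [b = 2] then contradicts [m = 4]. *)
  pose w := (s ^+ (p ^ (n - 3)))%g.
  have uE : u = (w ^+ 2)%g.
    by rewrite /u /w -expgnA -[in RHS]p2 -expnSr; congr (_ ^+ (_ ^ _))%g; lia.
  have w2 : vge (1 + 1) (sg w t - t) by apply: vge_expg.
  have [] : 4 <= m - 1 -> False by rewrite m4.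
  rewrite p2 in lower pk; apply: (lower 2) => //.
  have -> : sg u t - t = iter 2 (dsg w) t by rewrite iter_dsg_pchar // (powE w u 2).
  exact: (sgB_vge (b := 1) isT w2).
split=> //; rewrite m4 subrK in rm.
by move: rm; rewrite rE n2 p2 expn1.
Qed.

End OrderAndBreak.

(** * Normal form of the automorphisms of order 4 *)

(** The symmetric relation is multiplied by [t * u / (t + u) ^+ 3]; what is left over is a multiple
    of 2. *)
Lemma weierstrass_equation (F : fieldType) (a b c d t u : F) : 2%:R = 0 :> F ->
  t + u != 0 ->
  a * (t + u) + b * (t ^+ 2 + u ^+ 2) + c * (t * u * (t + u)) + d * (t ^+ 2 * u ^+ 2) = 0 ->
  let w := t * u / (t + u) in let y := u / (t + u) in
  a * (y ^+ 2 + y) = d * w ^+ 3 + c * w ^+ 2 + b * w.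
Proof.
move=> h2 tu rel w y; apply/eqP; rewrite -subr_eq0; apply/eqP.
have -> : a * (y ^+ 2 + y) - (d * w ^+ 3 + c * w ^+ 2 + b * w) =
  t * u / (t + u) ^+ 3 *
  (a * (t + u) + b * (t ^+ 2 + u ^+ 2) + c * (t * u * (t + u)) + d * (t ^+ 2 * u ^+ 2))
  + 2%:R * (a * u ^+ 2 / (t + u) ^+ 2 - d * w ^+ 3 - c * w ^+ 2
            - b * (t * u * (t ^+ 2 + u ^+ 2 + t * u)) / (t + u) ^+ 3).
  by rewrite /w /y; field.
by rewrite rel h2 mulr0 mul0r addr0.
Qed.

Lemma mul_div_cancel (F : fieldType) (a b c f : F) : b != 0 ->
  f * (c * a) = a * b * (f * (c / b)).
Proof. by move=> b0; field. Qed.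

Lemma scale_cubic (F : fieldType) (d b c w : F) : d != 0 ->
  (d * w ^+ 3 + c * w ^+ 2 + b * w) / d = w ^+ 3 + c / d * w ^+ 2 + b / d * w.
Proof. by move=> d0; field. Qed.

(** * Integrality over k[w] *)

Section IntegralRatio.
Variable k : fieldType.
Local Notation K := (laurent k).
Local Notation t := (laurent_t k).
Implicit Types (x y z w : K) (P Q : {poly k}) (F H : {poly {poly k}}) (m : int).

Lemma ev2_map_polyC x y P : ev2 x y (map_poly polyC P) = ev y P.
Proof.
rewrite /ev2 -map_poly_comp /ev; congr (_.[_]).
by apply: eq_map_poly => c; rewrite /= evC.
Qed.

Lemma ev2_MXsubY x y H : ev2 x y (H * ('X - 'X%:P)) = ev2 x y H * (y - x).
Proof. by rewrite rmorphM rmorphB /= ev2X ev2C evX. Qed.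

Lemma ev2B x y F H : ev2 x y (F - H) = ev2 x y F - ev2 x y H.
Proof. by rewrite /ev2 rmorphB hornerD hornerN. Qed.

Section Transcendental.
Variable w : K.
Hypothesis w_trans : forall P, (ev w P == 0) = (P == 0).

Lemma adjoin1_coprime y : adjoin [set w]%classic y ->
  exists P Q, [/\ coprimep P Q, Q != 0 & y = ev w P / ev w Q].
Proof.
move=> /adjoin1P[P [Q [Q0 ->]]]; rewrite w_trans in Q0.
have g0 : gcdp P Q != 0 by rewrite gcdp_eq0 negb_and Q0 orbT.
have coPQ : coprimep (P %/ gcdp P Q) (Q %/ gcdp P Q).
  by apply: coprimep_div_gcd; rewrite Q0 orbT.
have := divpK (dvdp_gcdl P Q); have := divpK (dvdp_gcdr P Q).
move: coPQ g0; move: (gcdp P Q) (Q %/ gcdp P Q) (P %/ gcdp P Q) => g Q' P' coPQ g0 QE PE.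
exists P', Q'; split=> //; first by apply: contraNneq Q0 => Q'0; rewrite -QE Q'0 mul0r.
rewrite -PE -QE !(rmorphM (ev w)) /= -mulf_div divff ?mulr1 //.
by rewrite w_trans.
Qed.

(* The rational root theorem over k[w]. *)
Lemma integral_ratio (F : {poly {poly k}}) (c : k) y : c != 0 -> lead_coef F = c%:P ->
  adjoin [set w]%classic y -> ev2 w y F = 0 -> exists P, y = ev w P.
Proof.
move=> c0 lF /adjoin1_coprime[P [Q [PQ Q0 yE]]] Fy.
have F0 : F != 0 by rewrite -lead_coef_eq0 lF polyC_eq0.
have eQ0 : ev w Q != 0 by rewrite w_trans.
have [n sF] : exists n, size F = n.+1 by exists (size F).-1; rewrite prednK // size_poly_gt0.
have S0 : \sum_(i < n.+1) F`_i * (P ^+ i * Q ^+ (n - i)) = 0.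
  apply/eqP; rewrite -w_trans rmorph_sum; apply/eqP.
  transitivity (ev w Q ^+ n * ev2 w y F); last by rewrite Fy mulr0.
  rewrite /ev2 horner_coef size_map_poly_id0 ?sF; last first.
    by rewrite lF evC; apply: (hval_neq0 (hval_cst c0)).
  rewrite mulr_sumr; apply: eq_bigr => i _; rewrite coef_map /=.
  rewrite yE; move: (ltn_ord i); rewrite ltnS => le_in.
  rewrite !(rmorphM (ev w)) !(rmorphXn (ev w)) /= expr_div_n.
  have -> : ev w Q ^+ n = ev w Q ^+ (n - i) * ev w Q ^+ i by rewrite -exprD subnK.
  by apply: mul_div_cancel; apply: expf_neq0.
(* In the relation cleared of denominators every term but the leading one contains [Q], and the
   leading coefficient is a constant. *)
have QP : Q %| P ^+ n.
  rewrite big_ord_recr /= subnn mulr1 in S0.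
  have -> : P ^+ n = c^-1 *: - (\sum_(i < n) F`_i * (P ^+ i * Q ^+ (n - i))).
    move/eqP: S0; rewrite addr_eq0 => /eqP ->.
    have -> : F`_n = c%:P by rewrite -lF lead_coefE sF.
    by rewrite opprK mul_polyC scalerA mulVf // scale1r.
  rewrite dvdpZr ?invr_eq0 // dvdpNr; elim/big_ind: _ => [|A B QA QB|i _].
  - exact: dvdp0.
  - exact: dvdp_add.
  apply/dvdp_mull/dvdp_mull/dvdp_exp => //.
  by rewrite subn_gt0.
have : size Q == 1%N.
  rewrite -coprimepp; apply: coprimep_dvdr QP _; exact: coprimep_expl.
move=> /size_poly1P[d d0 QE]; exists (d^-1 *: P).
by rewrite yE QE evC -mul_polyC (rmorphM (ev w)) /= evC fmorphV mulrC.
Qed.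

End Transcendental.
End IntegralRatio.

(** * A Weierstrass equation from the relation between t and its conjugate *)

Section Classification.
Variable k : fieldType.
Local Notation K := (laurent k).
Local Notation t := (laurent_t k).
Implicit Types (x y z w : K) (P Q : {poly k}) (F H : {poly {poly k}}) (m : int).
Variables (s r : fps_aut k) (beta : K).
Hypothesis pchar2 : 2%N \in [pchar k].
Hypothesis wp_beta : adjoin [set t]%classic (wp 2 beta).
Hypothesis LE : adjoin [set to_laurent (u (fpsX k)) | u in subgroup_gen s]%classic
              = adjoin [set t; beta]%classic.
Hypothesis rE : r = (s ^+ 2)%g.
Local Notation t' := (sg r t).
Hypothesis r_invol : (r ^+ 2 = 1)%g.
Hypothesis r_break : hval (t' - t) 4.

Lemma laurent_pchar2 : 2%:R = 0 :> K.
Proof. by rewrite -(rmorph_nat (@cst k)) (pcharf0 pchar2) rmorph0. Qed.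

Lemma laurent_addxx x : x + x = 0.
Proof. by rewrite -mulr2n -mulr_natl laurent_pchar2 mul0r. Qed.

Lemma laurent_oppx x : - x = x.
Proof. by apply/eqP; rewrite -subr_eq0 -opprD laurent_addxx oppr0. Qed.

Lemma sg_rE x : sg r x = sg s (sg s x).
Proof. by rewrite rE; apply: sgX. Qed.

Lemma sg_rK x : sg r (sg r x) = x.
Proof. by rewrite -[LHS](sgX r 2) r_invol sg1. Qed.

Lemma orbit_algebraic u : subgroup_gen s u ->
  exists F : {poly {poly k}}, [/\ F != 0, ev2 t (sg u t) F = 0 & (size F <= 3)%N].
Proof.
move=> Gu; have : adjoin [set t; beta]%classic (sg u t).
  by rewrite -LE sg_fps; apply: adjoin_gen; exists u.
by move=> /(finite_action_adjoin wp_beta)/finite_action_algebraic.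
Qed.

(** Bidegree (1, 1) would give 4 <= 1 + 1 by [relation_bound]. *)
Lemma no_small_relation (H : {poly {poly k}}) : (size H <= 2)%N -> (size (swapXY H) <= 2)%N ->
  ev2 t t' H = 0 -> H = 0.
Proof.
move=> sH sH' Hr; apply/eqP/negPn/negP => H0.
have := relation_bound _ r_break H0 Hr sH sH'; rewrite /= => h.
suff : (4 : int) <= 1 + 1 by [].
by apply: h; apply: vge_sg; apply: vge_le (hval_vge (hval_t k)).
Qed.

Lemma diag_relation_eq0 (F : {poly {poly k}}) : (size F <= 3)%N -> (size (swapXY F) <= 3)%N ->
  ev2 t t' F = 0 -> F.['X] = 0 -> F = 0.
Proof.
move=> sF sF' Fr F0; have [H [FE sH sH']] := diag_eq0 F0.
rewrite FE; have [->|H0] := eqVneq H 0; first by rewrite mul0r.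
rewrite sH H0 addn1 ltnS in sF; rewrite sH' H0 addn1 ltnS in sF'.
have rH : ev2 t t' H = 0.
  move/eqP: Fr; rewrite FE ev2_MXsubY.
  by rewrite mulf_eq0 (negPf (hval_neq0 r_break)) orbF => /eqP.
by case/eqP: H0; apply: no_small_relation.
Qed.

(* The relation of bidegree (2, 2) between t and r t is symmetric, and on the
   diagonal it reduces to a multiple of T^4. *)
Lemma symmetric_relation : exists a b c d : k, d != 0 /\
  cst a * (t + t') + cst b * (t ^+ 2 + t' ^+ 2) + cst c * (t * t' * (t + t'))
  + cst d * (t ^+ 2 * t' ^+ 2) = 0.
Proof.
have Gr : subgroup_gen s r by rewrite rE; apply: subgroup_genX.
have [F1 [F10 F1r sF1]] := orbit_algebraic Gr.
have [F2 [F20 F2r sF2]] := orbit_algebraic (subgroup_genV Gr).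
have [F [F0 Fr sF sF']] := aut_relation F10 F1r F20 F2r.
have {}sF := leq_trans sF sF1; have {}sF' := leq_trans sF' sF2.
(* The difference of the two sides is again a relation, since [r] exchanges [t] and [r t], and it
   vanishes on the diagonal. *)
have Fsym : F = swapXY F.
  apply/eqP; rewrite -subr_eq0; apply/eqP; apply: diag_relation_eq0.
  - by rewrite (leq_trans (size_polyD _ _)) // size_polyN geq_max sF.
  - by rewrite swapXY_is_zmod_morphism swapXYK (leq_trans (size_polyD _ _)) // size_polyN geq_max sF'.
  - rewrite ev2B ev2_swapXY Fr sub0r; apply/eqP; rewrite oppr_eq0.
    by rewrite -[X in ev2 _ X]sg_rK -sg_ev2 Fr rmorph0.
  - apply/eqP; rewrite -ev_t_eq0 ev_diag ev2B ev2_swapXY.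
    by rewrite subrr.
have D0 : F.['X] != 0 by apply: contraNneq F0 => D0; rewrite (diag_relation_eq0 sF sF' Fr D0).
(* The value on the diagonal agrees with the relation, which is zero, up to order 4. *)
have Dlow i : (i < 4)%N -> F.['X]`_i = 0.
  move=> lt_i4; have : vge 4 (ev t F.['X]).
    rewrite ev_diag -[X in vge _ X]opprK -[- ev2 _ _ _]add0r -Fr; apply/vgeN.
    apply: vge_ev2B; last exact: hval_vge.
      exact: vge_le (hval_vge (hval_t k)).
    by apply: vge_sg; apply: vge_le (hval_vge (hval_t k)).
  rewrite -(poly_take_drop 4 F.['X]) (rmorphD (ev t)) (rmorphM (ev t)) (rmorphXn (ev t)) /= evX.
  move=> v4; have : vge 4 (ev t (take_poly 4 F.['X])).
    rewrite -[X in vge _ X](addrK (ev t (drop_poly 4 F.['X]) * t ^+ 4)).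
    apply: vgeB v4 _; rewrite mulrC; apply: vgeM0; first exact/hval_vge/(hvalX 4 (hval_t k)).
    by apply: vge_ev; apply: vge_le (hval_vge (hval_t k)).
  move=> /(@vge_le _ _ (size (take_poly 4 F.['X]))) v4'.
  have := vge_ev_size (v4' _); rewrite lez_nat size_take_poly => /(_ isT) T0.
  by rewrite T0 coefD coefMXn lt_i4 coef0 addr0.
have Fc i j : F`_i`_j = F`_j`_i by rewrite [in LHS]Fsym coef_swapXY.
have F3 i j : (2 < i)%N -> F`_j`_i = 0.
  by move=> i2; rewrite Fc [F`_i]nth_default ?coef0 // (leq_trans sF).
have DE : F.['X] = \sum_(i < 3) F`_i * 'X^i by rewrite (horner_coef_wide _ sF).
have c00 : F`_0`_0 = 0.
  have := Dlow 0%N isT.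
  by rewrite DE !big_ord_recr big_ord0 /= add0r !coefD !coefMXn /= !addr0.
have kadd (x : k) : x + x = 0 by rewrite -mulr2n -mulr_natl (pcharf0 pchar2) mul0r.
(* On the diagonal the two symmetric contributions to degree 2 cancel in characteristic 2, leaving
   this coefficient alone. *)
have c11 : F`_1`_1 = 0.
  have := Dlow 2%N isT.
  rewrite DE !big_ord_recr big_ord0 /= add0r !coefD !coefMXn /= Fc addrAC.
  by rewrite kadd add0r.
have c22 : F`_2`_2 != 0.
  apply: contraNneq D0 => c22; apply/eqP/polyP => i; rewrite coef0.
  case: (ltnP i 4) => [/Dlow //|i4].
  rewrite DE !big_ord_recr big_ord0 /= add0r !coefD !coefMXn.
  have [-> ->] : (i < 0)%N = false /\ (i < 1)%N = false by split; apply/negbTE; lia.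
  have -> : (i < 2)%N = false by apply/negbTE; lia.
  rewrite !(F3 (i - 0)%N) ?(F3 (i - 1)%N) ?add0r; try lia.
  have [->|i5] := eqVneq i 4; first exact: c22.
  by apply: F3; lia.
exists F`_0`_1, F`_0`_2, F`_1`_2, F`_2`_2; split=> //.
have evE (P : {poly k}) : (size P <= 3)%N ->
    ev t P = cst P`_0 + cst P`_1 * t + cst P`_2 * t ^+ 2.
  move=> sP; rewrite /ev (horner_coef_wide (n := 3)) ?(leq_trans (size_poly _ _)) //.
  by rewrite !big_ord_recr big_ord0 /= !coef_map /= add0r expr0 mulr1 expr1.
have sFi (i : nat) : (size (F`_i)%R <= 3)%N by rewrite (leq_trans (max_size_coefXY F i)) // sizeYE.
rewrite -[RHS]Fr /ev2 (horner_coef_wide (n := 3)) ?(leq_trans (size_poly _ _)) //.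
rewrite !big_ord_recr big_ord0 /= !coef_map /= !evE // c00 c11 (Fc 1 0)%N (Fc 2 0)%N (Fc 2 1)%N.
rewrite rmorph0; ring.
Qed.

(** Write [r t] as [c0 + c1 * beta] over k(t). If [c1] were 0, [r t] would satisfy a relation of
    degree 1, and [break_upper_bound] would give 4 <= 1 + 2; so [beta] can be solved for. *)
Lemma adjoin_orbit x : adjoin [set t; beta]%classic x -> adjoin [set t; t']%classic x.
Proof.
move=> Lx; have Gr : subgroup_gen s r by rewrite rE; apply: subgroup_genX.
have Lt' : adjoin [set t; beta]%classic t'.
  by rewrite -LE sg_fps; apply: adjoin_gen; exists r.
have t_in z : adjoin [set t]%classic z -> adjoin [set t; t']%classic z.
  by apply: adjoin_sub => _ ->; apply: adjoin_gen; left.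
have [c [ct t'E]] := adjoin_beta_span wp_beta Lt'.
rewrite big_ord_recl big_ord1 /= expr0 mulr1 expr1 in t'E.
have c1 : c (lift ord0 ord0) != 0.
  apply/eqP => c1; rewrite c1 mul0r addr0 in t'E.
  have [P [Q [Q0 PQ]]] := adjoin1P (ct ord0); rewrite -t'E in PQ.
  have [F2 [F20 F2r sF2]] := orbit_algebraic (subgroup_genV Gr).
  pose F1 : {poly {poly k}} := Q%:P * 'X + (- P)%:P.
  have Q0' : Q != 0 by rewrite -ev_t_eq0.
  have sF1 : size F1 = 2%N.
    by rewrite size_MXaddC polyC_eq0 (negPf Q0') size_polyC Q0'.
  have F10 : F1 != 0 by rewrite -size_poly_gt0 sF1.
  have F1r : ev2 t t' F1 = 0.
    rewrite /F1 polyCN ev2B rmorphM /= ev2X !ev2C [X in _ * X]PQ.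
    by rewrite mulrCA divff // mulr1 subrr.
  have := break_upper_bound F10 F1r F20 F2r r_break; rewrite sF1 /=.
  by case: (size F2) sF2 => [|[|[|[|i]]]].
apply: (adjoin_sub _ Lx) => _ [->|->]; first by apply: adjoin_gen; left.
have -> : beta = (t' - c ord0) / c (lift ord0 ord0).
  by apply: (mulIf c1); rewrite divfK // t'E addrC addKr mulrC.
apply: adjoin_div; last exact: t_in.
by apply: adjoinB; [apply: adjoin_gen; right|apply: t_in].
Qed.

Lemma adjoin_orbit_sg x :
  adjoin [set t; t']%classic x -> adjoin [set t; t']%classic (sg s x).
Proof.
move=> Lx; apply: adjoin_orbit; rewrite -LE.
have gs u : subgroup_gen s u -> adjoin
    [set to_laurent (u (fpsX k)) | u in subgroup_gen s]%classic (sg s (sg u t)).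
  move=> Gu; rewrite -sgM sg_fps; apply: adjoin_gen; exists (s * u)%g => //.
  by apply: subgroup_genM => //; apply: subgroup_gen_id.
apply: (adjoin_sg _ Lx) => _ [->|->].
  by rewrite -[t]sg1; apply: gs; have := @subgroup_genX _ s 0; rewrite expg0.
by apply: gs; rewrite rE; apply: subgroup_genX.
Qed.

Lemma elliptic_model : exists w y, exists a b c : k,
  [/\ a != 0, hval w (-2), hval y (-3),
      cst a * (y ^+ 2 + y) = w ^+ 3 + cst c * w ^+ 2 + cst b * w &
  [/\ adjoin [set t; t']%classic w, adjoin [set t; t']%classic y,
      forall z, adjoin [set t; t']%classic z -> adjoin [set w; y]%classic z,
      sg r w = w & sg r y = y + 1]].
Proof.
have [a [b [c [d [d0 rel]]]]] := symmetric_relation.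
have tt : hval (t + t') 4 by have -> : t + t' = t' - t by rewrite laurent_oppx addrC.
have tt0 := hval_neq0 tt.
have vt := hval_t k; have vt' := hval_sg r vt.
have t0 := hval_neq0 vt; have t'0 := hval_neq0 vt'.
have := weierstrass_equation laurent_pchar2 tt0 rel.
set w := t * t' / (t + t'); set y := t' / (t + t') => /= wyE.
have vw : hval w (-2) by apply: (hvalM (hvalM vt vt') (hvalV tt)).
have vy : hval y (-3) by apply: (hvalM vt' (hvalV tt)).
(* Otherwise a cubic in [w], with a pole of order exactly 6, would be zero. *)
have a0 : a != 0.
  apply/eqP => a0; rewrite a0 rmorph0 mul0r in wyE.
  have : hval (cst d * w ^+ 3 + (cst c * w ^+ 2 + cst b * w)) (-6).
    apply: hvalD; first exact: (hvalM (hval_cst d0) (hvalX 3 vw)).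
    apply: vgeD; rewrite mulrC; apply: vgeM0; try exact: vge_cst.
      exact: vge_le (hval_vge (hvalX 2 vw)).
    exact: vge_le (hval_vge vw).
  by move/hval_neq0; rewrite addrA -wyE eqxx.
have rt : sg r (t + t') = t + t' by rewrite rmorphD /= sg_rK addrC.
exists w, y, (a / d), (b / d), (c / d); split=> //.
- by rewrite mulf_neq0 // invr_eq0.
- have cd0 := hval_neq0 (hval_cst d0).
  rewrite !fmorph_div /= mulrAC wyE; move: cd0; move: (cst d) (cst b) (cst c).
  by move=> ? ? ?; apply: scale_cubic.
have Lt : adjoin [set t; t']%classic t by apply: adjoin_gen; left.
have Lt' : adjoin [set t; t']%classic t' by apply: adjoin_gen; right.
(* Together with [r t = w / (y + 1)] this recovers both generators from [w] and [y]. *)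
have wy : t = w / y.
  by rewrite /w /y invf_div mulrA divfK // mulfK.
split.
- by apply: adjoin_div; [apply: adjoinM|apply: adjoinD].
- by apply: adjoin_div => //; apply: adjoinD.
- have Lw : adjoin [set w; y]%classic w by apply: adjoin_gen; left.
  have Ly : adjoin [set w; y]%classic y by apply: adjoin_gen; right.
  move=> z; apply: adjoin_sub => _ [->|->]; first by rewrite wy; apply: adjoin_div.
  have -> : t' = w / (y + 1).
    have yE : y + 1 = t / (t + t').
      by rewrite -[1](divff tt0) -mulrDl addrCA laurent_addxx addr0.
    by rewrite yE /w invf_div mulrA divfK // mulrC mulKf.
  by apply: adjoin_div => //; apply: adjoinD => //; apply: adjoin1.
- by rewrite /w fmorph_div rmorphM /= rt sg_rK [t' * t]mulrC.
- rewrite /y fmorph_div /= rt sg_rK.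
  rewrite -[1](divff tt0) -mulrDl; congr (_ / _).
  by rewrite addrCA laurent_addxx addr0.
Qed.

End Classification.

(** The fraction is expanded by the conjugate [C + D * (y + 1)] of the denominator; [N] is the norm
    of [C + D * y]. *)
Lemma quadratic_ratio (F : fieldType) (A B C D y q : F) : 2%:R = 0 :> F ->
  y ^+ 2 + y = q -> (C + D * y) * (C + D * (y + 1)) != 0 -> C + D * y != 0 ->
  let N := C ^+ 2 + C * D + D ^+ 2 * q in
  (A + B * y) / (C + D * y) =
  (A * (C + D) + B * D * q) / N + (A * D + B * C) / N * y.
Proof.
move=> char2 <- N0 CD0 /=.
have NE : C ^+ 2 + C * D + D ^+ 2 * (y ^+ 2 + y) = (C + D * y) * (C + D * (y + 1)).
  apply/eqP; rewrite -subr_eq0; apply/eqP.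
  have -> : C ^+ 2 + C * D + D ^+ 2 * (y ^+ 2 + y) - (C + D * y) * (C + D * (y + 1)) =
    2%:R * - (C * D * y) by ring.
  by rewrite char2 mul0r.
rewrite NE; move: (N0); rewrite mulf_eq0 negb_or => /andP[_ CD1].
by field; rewrite CD0 CD1.
Qed.

Lemma rmorph_cubic (k F : fieldType) (f : {rmorphism k -> F}) (b c B : k) :
  f (B ^+ 3 + c * B ^+ 2 + b * B) = f B ^+ 3 + f c * f B ^+ 2 + f b * f B.
Proof. by rewrite !(rmorphD, rmorphM, rmorphXn). Qed.

Lemma rmorph_weierstrass (F : fieldType) (f : {rmorphism F -> F}) (a b c w y : F) :
  a * (y ^+ 2 + y) = w ^+ 3 + c * w ^+ 2 + b * w -> f a = a -> f b = b -> f c = c ->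
  a * (f y ^+ 2 + f y) = f w ^+ 3 + c * f w ^+ 2 + b * f w.
Proof.
move=> E fa fb fc; have := congr1 f E.
by rewrite !(rmorphD, rmorphM, rmorphXn) fa fb fc.
Qed.

Lemma rmorph_quadratic (k F : fieldType) (f : {rmorphism k -> F}) (w : F)
    (a b c B h1 h0 : k) : 2%:R = 0 :> F ->
  f a * ((f h1 * w + f h0) ^+ 2 + (f h1 * w + f h0)) =
    f B * w ^+ 2 + f (B ^+ 2) * w + f (B ^+ 3 + c * B ^+ 2 + b * B) ->
  f (a * h1 ^+ 2 - B) * w ^+ 2 + f (a * h1 - B ^+ 2) * w
    + f (a * (h0 ^+ 2 + h0) - (B ^+ 3 + c * B ^+ 2 + b * B)) = 0.
Proof.
move=> char2 E.
transitivity (f a * ((f h1 * w + f h0) ^+ 2 + (f h1 * w + f h0))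
  - (f B * w ^+ 2 + f (B ^+ 2) * w + f (B ^+ 3 + c * B ^+ 2 + b * B))
  - 2%:R * (f a * f h1 * f h0 * w)); last by rewrite E subrr char2 mul0r subr0.
by rewrite !(rmorphB, rmorphD, rmorphM, rmorphXn); ring.
Qed.

(** Adding [g * (w / B)] to [y] cancels the linear term of the cubic in characteristic 2. *)
Lemma weierstrass_rescale (F : fieldType) (b c B g w y : F) : 2%:R = 0 :> F -> B != 0 ->
  B ^+ 3 * (y ^+ 2 + y) = w ^+ 3 + c * w ^+ 2 + b * w -> g = b / B ^+ 2 ->
  (y + g * (w / B)) ^+ 2 + (y + g * (w / B)) =
    (w / B) ^+ 3 + (c / B + g ^+ 2) * (w / B) ^+ 2.
Proof.
move=> char2 B0 E gE.
have -> : (y + g * (w / B)) ^+ 2 + (y + g * (w / B)) =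
  B ^+ 3 * (y ^+ 2 + y) / B ^+ 3 + g ^+ 2 * (w / B) ^+ 2 + g * (w / B)
  + 2%:R * (y * g * (w / B)) by field.
have -> : B ^+ 3 * (y ^+ 2 + y) / B ^+ 3 + g ^+ 2 * (w / B) ^+ 2 + g * (w / B)
  + 2%:R * (y * g * (w / B)) = (w / B) ^+ 3 + (c / B + g ^+ 2) * (w / B) ^+ 2
  + 2%:R * (y * g * (w / B) + b * w / B ^+ 3) by rewrite E gE; field.
by rewrite char2 mul0r addr0.
Qed.

Lemma translate_cubic (F : fieldType) (w y : F) (a b c B h : F) : 2%:R = 0 :> F ->
  a * (y ^+ 2 + y) = w ^+ 3 + c * w ^+ 2 + b * w ->
  a * ((y + h) ^+ 2 + (y + h)) = (w + B) ^+ 3 + c * (w + B) ^+ 2 + b * (w + B) ->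
  a * (h ^+ 2 + h) = B * w ^+ 2 + B ^+ 2 * w + (B ^+ 3 + c * B ^+ 2 + b * B).
Proof.
move=> char2 E E'; apply: (addrI (a * (y ^+ 2 + y))); rewrite {2}E.
transitivity (a * ((y + h) ^+ 2 + (y + h))); first by ring: char2.
have -> : a * ((y + h) ^+ 2 + (y + h)) =
  w ^+ 3 + c * w ^+ 2 + b * w + (B * w ^+ 2 + B ^+ 2 * w + (B ^+ 3 + c * B ^+ 2 + b * B))
  + 2%:R * (w ^+ 2 * B + w * B ^+ 2 + c * w * B) by rewrite E'; ring.
by rewrite char2 mul0r addr0.
Qed.

(** * The normal form of sigma on the curve *)

Section Model.
Variable k : fieldType.
Local Notation K := (laurent k).
Local Notation t := (laurent_t k).
Implicit Types (x y z w : K) (P Q : {poly k}) (F H : {poly {poly k}}) (m : int).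
Implicit Types (s r u : fps_aut k).
Hypothesis pchar2 : 2%N \in [pchar k].

(* An automorphism of order 4 of the curve y^2 + y = x^3 + (b^2 + b + 1) x^2
   fixing the point at infinity. *)
Definition model s (b : k) x y : Prop :=
  [/\ hval x (-2), hval y (-3),
      y ^+ 2 + y = x ^+ 3 + cst (b ^+ 2 + b + 1) * x ^+ 2,
      sg s x = x + 1 & sg s y = y + x + cst b].

Section NormalForm.
Variables (s r : fps_aut k) (w y : K) (a b c : k) (X : set K).
Hypothesis rE : forall z, sg r z = sg s (sg s z).
Hypothesis s_depth : vge 2 (sg s (laurent_t k) - laurent_t k).
Hypotheses (a0 : a != 0) (vw : hval w (-2)) (vy : hval y (-3)).
Hypothesis wyE : cst a * (y ^+ 2 + y) = w ^+ 3 + cst c * w ^+ 2 + cst b * w.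
Hypothesis LX : forall z, adjoin X z -> adjoin [set w; y]%classic z.
Hypotheses (Lw : adjoin X w) (Ly : adjoin X y).
Hypothesis LXs : forall z, adjoin X z -> adjoin X (sg s z).
Hypotheses (rw : sg r w = w) (ry : sg r y = y + 1).

Let h2 : 2%:R = 0 :> K := laurent_pchar2 pchar2.

Lemma fixed_base z : adjoin [set w]%classic z -> sg r z = z.
Proof.
move=> /adjoin1P[P [Q [Q0 ->]]].
by rewrite fmorph_div /= !sg_ev rw.
Qed.

Definition y_span z := exists A B, [/\ adjoin [set w]%classic A,
  adjoin [set w]%classic B & z = A + B * y].

Lemma y_spanB z z' : y_span z -> y_span z' -> y_span (z - z').
Proof.
move=> [A [B [wA wB ->]]] [A' [B' [wA' wB' ->]]].
exists (A - A'), (B - B'); split; [exact: adjoinB|exact: adjoinB|].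
by rewrite mulrBl opprD addrACA.
Qed.

Lemma y_span_div z z' : y_span z -> y_span z' -> y_span (z / z').
Proof.
move=> [A [B [wA wB ->]]] [C [D [wC wD ->]]].
have [CD0|CD0] := eqVneq (C + D * y) 0.
  exists 0, 0; split; [exact: adjoin0|exact: adjoin0|].
  by rewrite CD0 invr0 mulr0 mul0r addr0.
pose q : K := (w ^+ 3 + cst c * w ^+ 2 + cst b * w) / cst a.
have ww : adjoin [set w]%classic w by apply: adjoin_gen.
have wq : adjoin [set w]%classic q.
  have wc e : adjoin [set w]%classic (cst e) by apply: adjoin_cst.
  apply: (adjoin_div _ (wc a)); apply: adjoinD; last exact: adjoinM.
  by apply: adjoinD; [apply: adjoinX|apply: adjoinM => //; apply: adjoinX].
have yq : y ^+ 2 + y = q by rewrite /q -wyE mulrC mulKf // (hval_neq0 (hval_cst a0)).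
(* The second factor is the image of the first under [r], which fixes k(w) and maps [y] to
   [y + 1]. *)
have N0 : (C + D * y) * (C + D * (y + 1)) != 0.
  rewrite mulf_neq0 // -ry -(fixed_base wC) -(fixed_base wD) -rmorphM -rmorphD.
  by rewrite fmorph_eq0.
have wN : adjoin [set w]%classic (C ^+ 2 + C * D + D ^+ 2 * q).
  by apply: adjoinD; [apply: adjoinD; [apply: adjoinX|apply: adjoinM]|
                      apply: adjoinM => //; apply: adjoinX].
exists ((A * (C + D) + B * D * q) / (C ^+ 2 + C * D + D ^+ 2 * q)).
exists ((A * D + B * C) / (C ^+ 2 + C * D + D ^+ 2 * q)); split.
- apply: (adjoin_div _ wN); apply: adjoinD; first by apply: adjoinM => //; apply: adjoinD.
  by apply: adjoinM => //; apply: adjoinM.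
- by apply: (adjoin_div _ wN); apply: adjoinD; apply: adjoinM.
exact: quadratic_ratio.
Qed.

Lemma adjoin_y_span z : adjoin [set w; y]%classic z -> y_span z.
Proof.
move: z; apply: adjoin_min => [e|z [->|->]|z z'|z z'].
- exists (cst e), 0; split; [exact: adjoin_cst|exact: adjoin0|by rewrite mul0r addr0].
- exists w, 0; split; [exact: adjoin_gen|exact: adjoin0|by rewrite mul0r addr0].
- exists 0, 1; split; [exact: adjoin0|exact: adjoin1|by rewrite mul1r add0r].
- exact: y_spanB.
- exact: y_span_div.
Qed.

(** On [A + B * y] with [A] and [B] in k(w), the automorphism [r] adds [B]. *)
Lemma fixed_adjoin z : adjoin X z -> sg r z = z -> adjoin [set w]%classic z.
Proof.
move=> /LX/adjoin_y_span[A [B [wA wB ->]]].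
rewrite rmorphD rmorphM /= ry (fixed_base wA) (fixed_base wB) mulrDr mulr1 addrA.
rewrite -[in RHS](addr0 (A + B * y)) => /addrI ->.
by rewrite mul0r addr0.
Qed.

Lemma sg_r_comm z : sg r (sg s z) = sg s (sg r z).
Proof. by rewrite !rE. Qed.

(** Since [s] commutes with [r], [s w] is a fraction P/Q in [w], and the pole orders give deg P =
    deg Q + 1. Applying [s] again returns [w], so [s w] is a root of P(Y) - w Q(Y) and is integral
    over k[w]. It is thus a polynomial, linear by its pole order, and its slope squares to 1. *)
Lemma sg_w : exists B, sg s w = w + cst B.
Proof.
have wm : (-2 : int) < 0 by [].
have w_trans P : (ev w P == 0) = (P == 0) by apply: ev_eq0 vw wm.
have w1 : adjoin [set w]%classic (sg s w).
  by apply: fixed_adjoin; [exact: LXs|rewrite sg_r_comm rw].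
have vsw := hval_sg s vw.
have [P [Q [PQ Q0 wPQ]]] := adjoin1_coprime w_trans w1.
have eQ0 : ev w Q != 0 by rewrite (ev_eq0 _ vw).
have P0 : P != 0.
  apply/eqP => P0; have := hval_neq0 vsw; rewrite wPQ P0 rmorph0 mul0r.
  by rewrite eqxx.
have sPQ : size P = (size Q).+1.
  have vP := hval_ev vw wm P0; have vQ := hval_ev vw wm Q0.
  have := hvalM vP (hvalV vQ); rewrite -wPQ => /(hval_uniq vsw).
  have : (0 < size P)%N by rewrite size_poly_gt0.
  have : (0 < size Q)%N by rewrite size_poly_gt0.
  by case: (size P) => // i; case: (size Q) => // j _ _ /=; lia.
pose F : {poly {poly k}} := map_poly polyC P - 'X *: map_poly polyC Q.
have sPC : size (map_poly polyC P) = size P by rewrite size_map_polyC.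
have sF : (size ('X *: map_poly polyC Q)%R < size (map_poly polyC P))%N.
  by rewrite size_scale ?polyX_eq0 // !size_map_polyC sPQ.
have lF : lead_coef F = (lead_coef P)%:P.
  rewrite /F lead_coefDl ?size_polyN // lead_coefE sPC coef_map /=.
  by rewrite lead_coefE.
have Fw : ev2 w (sg s w) F = 0.
  rewrite /F ev2B ev2Z evX !ev2_map_polyC.
  have : sg s (sg s w) = sg s (ev w P / ev w Q) by rewrite -wPQ.
  rewrite fmorph_div /= !sg_ev -rE rw => wE.
  have eQ1 : ev (sg s w) Q != 0 by rewrite (ev_eq0 _ vsw).
  by rewrite [X in _ - X * _]wE divfK // subrr.
have lP0 : lead_coef P != 0 by rewrite lead_coef_eq0.
have [P' wP'] := integral_ratio w_trans lP0 lF w1 Fw.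
have P'0 : P' != 0.
  by apply/eqP => P'0; have := hval_neq0 vsw; rewrite wP' P'0 rmorph0 eqxx.
have sP' : size P' = 2%N.
  have := hval_ev vw wm P'0; rewrite -wP' => /(hval_uniq vsw).
  by have := size_poly_gt0 P'; rewrite P'0; case: (size P') => // i _ /=; lia.
have linP (x : K) : ev x P' = cst P'`_1 * x + cst P'`_0.
  rewrite /ev (horner_coef_wide (n := 2)) ?(leq_trans (size_poly _ _)) ?sP' //.
  by rewrite big_ord_recl big_ord1 /= !coef_map /= expr0 mulr1 expr1 addrC.
have : sg s (sg s w) = cst P'`_1 * sg s w + cst P'`_0.
  by rewrite {1}wP' sg_ev linP.
rewrite -rE rw wP' linP => wE.
have P1 : P'`_1 ^+ 2 - 1 = 0.
  have : ev w (('X * (P'`_1 ^+ 2 - 1)%:P) + (P'`_1 * P'`_0 + P'`_0)%:P) = 0.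
    rewrite mulrC ev_MXaddC evC -[RHS](subrr w) {2}wE.
    rewrite !(rmorphD, rmorphM, rmorphB, rmorphXn, rmorph1) /=; ring.
  move/eqP; rewrite (ev_eq0 _ vw) // => /eqP/(congr1 (fun p : {poly k} => p`_1)).
  by rewrite mulrC coefD coefMX coefC coefC coef0 addr0.
have {}P1 : P'`_1 = 1.
  apply/eqP; rewrite -subr_eq0; have : (P'`_1 - 1) ^+ 2 = 0.
    have -> : (P'`_1 - 1) ^+ 2 = P'`_1 ^+ 2 - 1 + 2%:R * (1 - P'`_1) by ring.
    by rewrite P1 (pcharf0 pchar2) mul0r addr0.
  by move/eqP; rewrite expf_eq0.
exists P'`_0.
by rewrite P1 rmorph1 mul1r.
Qed.

Lemma quadratic_eq0 (e2 e1 e0 : k) : cst e2 * w ^+ 2 + cst e1 * w + cst e0 = 0 ->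
  [/\ e2 = 0, e1 = 0 & e0 = 0].
Proof.
move=> E0; have : ev w ((e2%:P * 'X + e1%:P) * 'X + e0%:P) = 0.
  by rewrite !ev_MXaddC evC -[RHS]E0; ring.
move/eqP; rewrite (ev_eq0 _ vw) // => /eqP p0; split.
- by have := congr1 (fun p : {poly k} => p`_2) p0; rewrite !(coefD, coefMX, coefC) /= !addr0.
- by have := congr1 (fun p : {poly k} => p`_1) p0; rewrite !(coefD, coefMX, coefC) /= add0r addr0.
- by have := congr1 (fun p : {poly k} => p`_0) p0; rewrite !(coefD, coefMX, coefC) /= add0r.
Qed.

Lemma normal_form : exists b0 x y0, model s b0 x y0.
Proof.
have [B wB] := sg_w; have ca0 := hval_neq0 (hval_cst a0).
pose h : K := sg s y - y; have yh : sg s y = y + h by rewrite /h addrC subrK.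
have hh : h + sg s h = 1.
  have : sg s (sg s y) = y + 1 by rewrite -rE ry.
  rewrite yh rmorphD /= yh -addrA => /addrI; exact.
(* [y] has a pole of order 3, and s - 1 raises orders by at least one. *)
have vh : vge (-2) h by exact: (sgB_vge (b := 1) isT s_depth (hval_vge vy)).
have wh : adjoin [set w]%classic h.
  apply: fixed_adjoin; first by apply: adjoinB; [exact: LXs|].
  by rewrite /h rmorphB /= sg_r_comm ry rmorphD rmorph1 /= opprD addrACA subrr addr0.
have hE : cst a * (h ^+ 2 + h) =
    cst B * w ^+ 2 + cst (B ^+ 2) * w + cst (B ^+ 3 + c * B ^+ 2 + b * B).
  have := rmorph_weierstrass (f := sg s) wyE (sg_cst s a) (sg_cst s b) (sg_cst s c).
  rewrite /= yh wB => /(translate_cubic h2 wyE) ->.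
  by rewrite (rmorph_cubic (@cst k)) (rmorphXn (@cst k)).
have wm : (-2 : int) < 0 by [].
have w_trans P : (ev w P == 0) = (P == 0) by apply: ev_eq0 vw wm.
(* [h] is integral over k[w], since [h ^+ 2 + h] is a polynomial in [w]; its order then bounds the
   degree of [H] by 1. *)
have [H hH] : exists H : {poly k}, h = ev w H.
  pose T : {poly k} := (B%:P * 'X + (B ^+ 2)%:P) * 'X + (B ^+ 3 + c * B ^+ 2 + b * B)%:P.
  have evT : ev w T = cst a * (h ^+ 2 + h) by rewrite !ev_MXaddC evC hE; ring.
  pose F : {poly {poly k}} := 'X ^+ 2 + ('X - ((a^-1)%:P * T)%:P).
  have lF : lead_coef F = 1%:P.
    by rewrite /F lead_coefDl ?lead_coefXn // size_polyXn size_XsubC.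
  apply: (integral_ratio w_trans (oner_neq0 _) lF wh).
  rewrite /F rmorphD rmorphXn /= ev2X ev2B ev2X ev2C (rmorphM (ev w)) /=.
  by rewrite evC evT fmorphV mulKf // addrA subrr.
have sH : (size H <= 2)%N.
  have [->|H0] := eqVneq H 0; first by rewrite size_poly0.
  have := hval_vge_le (hval_ev vw wm H0); rewrite -hH => /(_ _ vh).
  by case: (size H) => [|[|[|i]]] //=; lia.
have {}hH : h = cst H`_1 * w + cst H`_0.
  rewrite hH /ev (horner_coef_wide (n := 2)) ?(leq_trans (size_poly _ _)) //.
  by rewrite big_ord_recl big_ord1 /= !coef_map /= expr0 mulr1 expr1 addrC.
move: hH; move: H`_1 H`_0 => h1 h0 hH.
(* From [h + s h = 1], because [s] adds [h1 * B] to [h]. *)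
have B1 : h1 * B = 1.
  apply: (@cst_inj k); rewrite rmorph1 rmorphM -hh hH rmorphD !rmorphM /= !sg_cst wB.
  have -> : cst h1 * w + cst h0 + (cst h1 * (w + cst B) + cst h0) =
    cst h1 * cst B + 2%:R * (cst h1 * w + cst h0) by ring.
  by rewrite h2 mul0r addr0.
have [E2 E1 E0] : [/\ a * h1 ^+ 2 - B = 0, a * h1 - B ^+ 2 = 0
                   & a * (h0 ^+ 2 + h0) - (B ^+ 3 + c * B ^+ 2 + b * B) = 0].
  apply: quadratic_eq0; rewrite hH in hE.
  exact: (@rmorph_quadratic k K (@cst k) w a b c B h1 h0 h2 hE).
have B0 : B != 0 by apply/eqP => B0; move: B1; rewrite B0 mulr0 => /eqP; rewrite eq_sym oner_eq0.
have h1E : h1 = B^-1 by apply: (mulIf B0); rewrite B1 mulVf.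
have aE : a = B ^+ 3.
  apply: (mulIf (invr_neq0 B0)); rewrite -h1E; move/eqP: E1; rewrite subr_eq0 => /eqP ->.
  by rewrite h1E; field.
have k2 : 2%:R = 0 :> k := pcharf0 pchar2.
have h0E : h0 ^+ 2 + h0 = 1 + c / B + b / B ^+ 2.
  apply: (mulfI (expf_neq0 3 B0)); rewrite -[in LHS]aE; move/eqP: E0; rewrite subr_eq0 => /eqP ->.
  by field.
(* Now [a = B ^+ 3]. The new coordinates are [w / B] and [y + g * (w / B)]; [s] adds [h0 + g] as the
   constant term, whence [b0]. *)
pose g := b / B ^+ 2; pose b0 := h0 + g.
have cB0 := hval_neq0 (hval_cst B0).
exists b0, (w / cst B), (y + cst g * (w / cst B)).
have vx : hval (w / cst B) (-2) by apply: (hvalM vw (hvalV (hval_cst B0))).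
have sx : sg s (w / cst B) = w / cst B + 1.
  by rewrite fmorph_div /= sg_cst wB mulrDl divff.
split=> //.
- apply: hvalD => //; rewrite mulrC; apply: vgeM0; [exact: hval_vge|exact: vge_cst].
- have b0E : b0 ^+ 2 + b0 + 1 = c / B + g ^+ 2.
    rewrite (_ : b0 ^+ 2 + b0 = h0 ^+ 2 + h0 + g ^+ 2 + g + 2%:R * (h0 * g)); last by rewrite /b0; ring.
    rewrite k2 mul0r addr0 h0E -/g.
    rewrite (_ : _ + 1 = c / B + g ^+ 2 + 2%:R * (1 + g)); last by ring.
    by rewrite k2 mul0r addr0.
  have cE : cst (c / B + g ^+ 2) = cst c / cst B + cst g ^+ 2.
    by rewrite rmorphD rmorphXn /= [cst (c / B)]fmorph_div.
  rewrite b0E cE.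
  have gE : cst g = cst b / cst B ^+ 2 by rewrite fmorph_div rmorphXn.
  have BE : cst a = cst B ^+ 3 by rewrite aE rmorphXn.
  have := wyE; rewrite BE => wyE'; exact: (weierstrass_rescale h2 cB0 wyE' gE).
rewrite rmorphD rmorphM /= sg_cst sx yh hH h1E fmorphV.
by rewrite /b0 rmorphD mulrDr mulr1; ring.
Qed.

End NormalForm.
End Model.

(** * Uniqueness of the parameter modulo the Artin-Schreier operator *)

Section Uniqueness.
Variable k : fieldType.
Local Notation K := (laurent k).
Local Notation t := (laurent_t k).
Implicit Types (x y z w : K) (s r u : fps_aut k).
Hypothesis pchar2 : 2%N \in [pchar k].

Let h2 : 2%:R = 0 :> K := laurent_pchar2 pchar2.
Let k2 : 2%:R = 0 :> k := pcharf0 pchar2.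

Lemma model_square s b x y : model s b x y ->
  sg s (sg s x) = x /\ sg s (sg s y) = y + 1.
Proof.
move=> [_ _ _ sx sy]; split.
  by rewrite sx rmorphD rmorph1 /= sx -addrA laurent_addxx // addr0.
rewrite sy !rmorphD /= sg_cst sx sy.
have -> : y + x + cst b + (x + 1) + cst b = y + 1 + 2%:R * (x + cst b) by ring.
by rewrite h2 mul0r addr0.
Qed.

(* For D = x' - x and E = y' - y, with e and d meant to be the leading coefficients
   of E / x and D, the right-hand side has smaller order than x ^+ 2. *)
Lemma model_difference (F : fieldType) (x y D E e a a' : F) : 2%:R = 0 :> F ->
  y ^+ 2 + y = x ^+ 3 + a * x ^+ 2 ->
  (y + E) ^+ 2 + (y + E) = (x + D) ^+ 3 + a' * (x + D) ^+ 2 ->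
  forall d, (e ^+ 2 - d - (a' - a)) * x ^+ 2 =
    - (E - e * x) ^+ 2 - E + x * D ^+ 2 + D ^+ 3 + a' * D ^+ 2 + (D - d) * x ^+ 2.
Proof.
move=> char2 E1 E2 d; apply/eqP; rewrite -subr_eq0; apply/eqP.
have -> : (e ^+ 2 - d - (a' - a)) * x ^+ 2 -
    (- (E - e * x) ^+ 2 - E + x * D ^+ 2 + D ^+ 3 + a' * D ^+ 2 + (D - d) * x ^+ 2)
  = ((y + E) ^+ 2 + (y + E) - ((x + D) ^+ 3 + a' * (x + D) ^+ 2))
    - (y ^+ 2 + y - (x ^+ 3 + a * x ^+ 2))
    + 2%:R * (e ^+ 2 * x ^+ 2 - E * e * x - y * E + x ^+ 2 * D + x * D ^+ 2 + a' * x * D) by ring.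
by rewrite E1 E2 !subrr char2 mul0r addr0.
Qed.

Lemma model_unique s r b x y b' x' y' :
  (forall z, sg r z = sg s (sg s z)) -> vge 2 (sg s t - t) -> hval (sg r t - t) 4 ->
  model s b x y -> model s b' x' y' -> exists a : k, b' - b = wp 2 a.
Proof.
move=> rE s_depth r_break M M'.
have [rx ry] := model_square M; have [rx' ry'] := model_square M'.
have [vx vy eq sx sy] := M; have [vx' vy' eq' sx' sy'] := M'.
have r4 : hval (sg r t - t) (3 + 1) by [].
have even z n : sg r z = z -> vge (2 * n + 1) z -> vge (2 * (n + 1)) z.
  exact: (fixed_vge pchar2 (b := 3) isT r4).
pose D : K := x' - x; pose E : K := y' - y.
have sD : sg s D = D by rewrite /D rmorphB /= sx sx' opprD addrACA subrr addr0.
have rD : sg r D = D by rewrite rE !sD.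
have rx_fixed : sg r x = x by rewrite rE.
(* Evenness of orders fixed by [r] makes [D - c * x] integral; [s] moves it by the constant [- c],
   which must have positive order. *)
have D0 : vge 0 D.
  have D2 : vge (-2) D by apply: vgeB; apply: hval_vge.
  have [c cD] := hval_lead vx D2.
  have rDc : sg r (D - cst c * x) = D - cst c * x.
    by rewrite rmorphB rmorphM /= sg_cst rD rx_fixed.
  have Dc0 : vge 0 (D - cst c * x) by apply: (even _ (-1)).
  have c0 : c = 0.
    apply: vge1_cst; have := sgB_vge (b := 1) isT s_depth Dc0.
    rewrite rmorphB rmorphM /= sg_cst sD sx mulrDr mulr1 => /vgeN.
    by congr (vge _ _); ring.
  by move: Dc0; rewrite c0 rmorph0 mul0r subr0.
have [d dD] := hval_lead (hval1 k) D0; rewrite mulr1 in dD.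
have rE' : sg r E = E.
  by rewrite /E rmorphB /= !rE ry ry' opprD addrACA subrr addr0.
have E2 : vge (-2) E.
  by apply: (even _ (-2)) => //; apply: vgeB; apply: hval_vge.
have [e eE] := hval_lead vx E2.
have rEe : sg r (E - cst e * x) = E - cst e * x.
  by rewrite rmorphB rmorphM /= sg_cst rE' rx_fixed.
have Ee0 : vge 0 (E - cst e * x) by apply: (even _ (-1)).
(* Since [s E - E = D + b' - b], this is the constant term of the amount by which [s] moves the
   integral element [E - e * x]. *)
have e_lin : d + (b' - b) - e = 0.
  apply: vge1_cst; rewrite rmorphB rmorphD rmorphB /=.
  have := vgeB (sgB_vge (b := 1) isT s_depth Ee0) dD.
  congr (vge _ _); rewrite rmorphB rmorphM /= sg_cst sx /E rmorphB /= sy sy' /D; ring.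
pose a := b ^+ 2 + b + 1; pose a' := b' ^+ 2 + b' + 1.
(* In [model_difference] the right-hand side has order at least -3, while [x ^+ 2] has order -4. *)
have e_quad : e ^+ 2 - d - (a' - a) = 0.
  have E_eq : (y + E) ^+ 2 + (y + E) = (x + D) ^+ 3 + cst a' * (x + D) ^+ 2.
    have -> : y + E = y' by rewrite /E addrC subrK.
    by have -> : x + D = x' by rewrite /D addrC subrK.
  have := model_difference (cst e) h2 eq E_eq (cst d).
  rewrite -/a -(rmorphXn (@cst k)) -!(rmorphB (@cst k)) => Ex.
  apply: vge1_cst; have vx2 := hvalX 2 vx.
  rewrite -[cst _](mulfK (hval_neq0 vx2)) Ex.
  apply: (@vgeM _ (-3) 4); last exact: (hval_vge (hvalV vx2)).
  have vg n z : vge n z -> -3 <= n -> vge (-3) z by move=> h1 h3; apply: vge_le h1.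
  apply: vgeD; last by apply: (@vgeM _ 1 (-4)) => //; apply: hval_vge.
  have D2 : vge 0 (D ^+ 2) by rewrite expr2; apply: (@vgeM0 _ 0).
  apply: vgeD; last first.
    by apply: (vg 0) => //; rewrite mulrC; apply: (@vgeM0 _ 0) => //; apply: vge_cst.
  apply: vgeD; last by apply: (vg 0) => //; rewrite exprS; apply: (@vgeM0 _ 0).
  apply: vgeD; last by apply: (vg (-2)) => //; apply: vgeM0 => //; apply: hval_vge.
  apply: vgeB; last exact: (vg (-2)).
  by apply: (vg 0) => //; apply: vgeN; rewrite expr2; apply: (@vgeM0 _ 0).
exists d; rewrite /wp.
have eE' : e = d + (b' - b) by apply/eqP; rewrite eq_sym -subr_eq0 e_lin.
apply/eqP; rewrite -subr_eq0; apply/eqP; rewrite -e_quad eE' /a /a'.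
have -> : (d + (b' - b)) ^+ 2 - d - (b' ^+ 2 + b' + 1 - (b ^+ 2 + b + 1)) =
  b' - b - (d ^+ 2 - d) + 2%:R * (d ^+ 2 - d - b' + b + d * b' - d * b - b * b' + b ^+ 2) by ring.
by rewrite k2 mul0r addr0.
Qed.

Lemma model_conj s u b x y : model s b x y ->
  model (s ^ u)%g b (sg u^-1%g x) (sg u^-1%g y).
Proof.
move=> [vx vy eq sx sy].
have conjE z : sg (s ^ u)%g (sg u^-1%g z) = sg u^-1%g (sg s z).
  by rewrite conjgE !sgM -(sgM u) mulgV sg1.
split; rewrite ?conjE ?sx ?sy; [exact: hval_sg|exact: hval_sg| | |].
- have := congr1 (sg u^-1%g) eq; rewrite !(rmorphD, rmorphM, rmorphXn) /=.
  by rewrite !sg_cst.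
- by rewrite rmorphD rmorph1.
- by rewrite !rmorphD /= sg_cst.
Qed.

End Uniqueness.

(** * The automorphisms sigma_b *)

Section CurveIdentities.
Variable F : fieldType.
Implicit Types a b x y t beta : F.
Hypothesis char2 : 2%:R = 0 :> F.

Lemma curve_automorphism b x y : y ^+ 2 + y = x ^+ 3 + (b ^+ 2 + b + 1) * x ^+ 2 ->
  (y + x + b) ^+ 2 + (y + x + b) = (x + 1) ^+ 3 + (b ^+ 2 + b + 1) * (x + 1) ^+ 2.
Proof.
move=> /eqP; rewrite -subr_eq0 => /eqP E; apply/eqP; rewrite -subr_eq0; apply/eqP.
transitivity (y ^+ 2 + y - (x ^+ 3 + (b ^+ 2 + b + 1) * x ^+ 2)
  + 2%:R * (y * b + x * y - 1 - 2%:R * x - x * b ^+ 2 - x ^+ 2)); first by ring.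
by rewrite E char2 mul0r addr0.
Qed.

(** On the left is the uniformizer [y / x ^+ 2] moved by the curve automorphism; on the right, the
    fraction of sigma_b at that uniformizer, with beta equal to [(y + a * x ^+ 2) / x ^+ 3] for
    [a = b ^+ 2 + b + 1]. *)
Lemma sigma_formula b x y : y ^+ 2 + y = x ^+ 3 + (b ^+ 2 + b + 1) * x ^+ 2 ->
  x != 0 -> x + 1 != 0 -> b ^+ 2 + (y / x ^+ 2) ^+ 2 != 0 ->
  (y + x + b) / (x + 1) ^+ 2 =
  (b ^+ 2 * (y / x ^+ 2) + (b + 1) * (y / x ^+ 2) ^+ 2
     + (y + (b ^+ 2 + b + 1) * x ^+ 2) / x ^+ 3) / (b ^+ 2 + (y / x ^+ 2) ^+ 2).
Proof.
move=> /eqP; rewrite -subr_eq0 => /eqP E x0 x1 d0.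
have poly_eq : (y + x + b) * (b ^+ 2 * x ^+ 4 + y ^+ 2) = (x + 1) ^+ 2 *
    (b ^+ 2 * x ^+ 2 * y + (b + 1) * y ^+ 2 + x * y + (b ^+ 2 + b + 1) * x ^+ 3).
  apply/eqP; rewrite -subr_eq0; apply/eqP.
  transitivity ((y ^+ 2 + y - (x ^+ 3 + (b ^+ 2 + b + 1) * x ^+ 2))
      * (y - 2%:R - x - 2%:R * x * b - x ^+ 2 - x ^+ 2 * b)
    + 2%:R * (y + x * y * b - x ^+ 2 - x ^+ 2 * b - x ^+ 2 * b ^+ 2 + x ^+ 2 * y * b
      - 2%:R * x ^+ 3 - 2%:R * x ^+ 3 * b - 2%:R * x ^+ 3 * b ^+ 2 - x ^+ 3 * b ^+ 3
      - x ^+ 3 * y * b ^+ 2 - 2%:R * x ^+ 4 - 3%:R * x ^+ 4 * b - 2%:R * x ^+ 4 * b ^+ 2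
      - x ^+ 5 - x ^+ 5 * b)); first by ring.
  by rewrite E char2 !mul0r addr0.
apply/eqP; rewrite eqr_div ?expf_neq0 //; apply/eqP.
transitivity ((y + x + b) * (b ^+ 2 * x ^+ 4 + y ^+ 2) / x ^+ 4); first by field.
by rewrite poly_eq; field.
Qed.

Lemma beta_of_curve a x y : y ^+ 2 + y = x ^+ 3 + a * x ^+ 2 -> x != 0 ->
  (y + a * x ^+ 2) / x ^+ 3 = y ^+ 2 / x ^+ 3 + 1.
Proof.
move=> E x0; have -> : y + a * x ^+ 2 = y ^+ 2 + x ^+ 3.
  have -> : a * x ^+ 2 = y ^+ 2 + y - x ^+ 3 by rewrite E addrC addKr.
  transitivity (y ^+ 2 + x ^+ 3 + 2%:R * (y - x ^+ 3)); first by ring.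
  by rewrite char2 mul0r addr0.
by rewrite mulrDl divff // expf_neq0.
Qed.

Lemma beta_equation a x y : y ^+ 2 + y = x ^+ 3 + a * x ^+ 2 -> x != 0 ->
  let beta := (y + a * x ^+ 2) / x ^+ 3 in
  beta ^+ 2 - beta = (y / x ^+ 2) ^+ 3 + a * (y / x ^+ 2) ^+ 2.
Proof.
move=> E x0 /=.
have -> : (y / x ^+ 2) ^+ 3 + a * (y / x ^+ 2) ^+ 2 =
  y ^+ 2 / x ^+ 3 * ((y + a * x ^+ 2) / x ^+ 3) by field.
rewrite beta_of_curve //.
transitivity (y ^+ 2 / x ^+ 3 * (y ^+ 2 / x ^+ 3 + 1)); last by [].
by ring.
Qed.

Lemma x_of_beta a x y : y ^+ 2 + y = x ^+ 3 + a * x ^+ 2 -> x != 0 -> y != 0 ->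
  ((y + a * x ^+ 2) / x ^+ 3 + 1) / (y / x ^+ 2) ^+ 2 = x.
Proof.
move=> E x0 y0; rewrite beta_of_curve //.
transitivity (x + 2%:R * (x ^+ 4 / y ^+ 2)); first by field; rewrite x0 y0.
by rewrite char2 mul0r addr0.
Qed.

(** Inverse of the passage from curve coordinates to [t] and [beta]; see [x_of_beta]. *)
Lemma curve_of_beta a beta t : beta ^+ 2 - beta = t ^+ 3 + a * t ^+ 2 -> t != 0 ->
  let x := (beta + 1) / t ^+ 2 in let y := t * x ^+ 2 in
  y ^+ 2 + y = x ^+ 3 + a * x ^+ 2.
Proof.
move=> /eqP; rewrite -subr_eq0 => /eqP E t0 /=; apply/eqP; rewrite -subr_eq0; apply/eqP.
transitivity ((beta + 1) ^+ 2 / t ^+ 6 * ((beta ^+ 2 - beta - (t ^+ 3 + a * t ^+ 2))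
  + 2%:R * (beta + t ^+ 3))); first by field.
by rewrite E char2 mul0r addr0 mulr0.
Qed.

Lemma beta_of_beta a beta t : beta ^+ 2 - beta = t ^+ 3 + a * t ^+ 2 -> t != 0 ->
  beta + 1 != 0 ->
  let x := (beta + 1) / t ^+ 2 in let y := t * x ^+ 2 in
  (y + a * x ^+ 2) / x ^+ 3 = beta.
Proof.
move=> E t0 b0 x y; have x0 : x != 0 by rewrite mulf_neq0 // invr_neq0 // expf_neq0.
rewrite (beta_of_curve (curve_of_beta E t0)) //.
transitivity (beta + 2%:R); first by rewrite /y /x; field; rewrite b0 t0.
by rewrite char2 addr0.
Qed.

End CurveIdentities.

(** * Substituting a uniformizer gives an automorphism of k[[t]] *)

Section Substitution.
Variables (k : fieldType) (u : fps k).
Hypothesis u0 : u 0%N != 0.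
Implicit Types (f g h : fps k) (P : {poly k}).
Local Notation T := (fpsX k * u).

Lemma coef_Texp i n : (n < i)%N -> (T ^+ i) n = 0.
Proof. by move=> lt_ni; rewrite exprMn coef_fpsXnM lt_ni. Qed.

Lemma coef_Texp_diag n : (T ^+ n) n = u 0%N ^+ n.
Proof.
rewrite exprMn coef_fpsXnM ltnn subnn; elim: n => [//|n IHn].
by rewrite exprS coef_fpsM0 IHn exprS.
Qed.

(** The sum is finite because [T ^+ i] has order at least [i]. *)
Definition fps_comp f : fps k :=
  Fps (fun n => \sum_(i < n.+1) f i * (T ^+ i) n).

Lemma coef_fps_sum (I : Type) (r : seq I) (G : I -> fps k) n :
  (\sum_(i <- r) G i) n = \sum_(i <- r) G i n.
Proof. by elim/big_rec2: _ => //= i x y _ <-. Qed.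

Lemma coef_fpsZ c f n : (c *: f) n = c * f n.
Proof. by []. Qed.

Definition poly_comp_T P : fps k := (map_poly (in_alg (fps k)) P).[T].

Lemma coef_poly_comp P n : poly_comp_T P n = \sum_(i < n.+1) P`_i * (T ^+ i) n.
Proof.
rewrite /poly_comp_T (horner_coef_wide (n := maxn n.+1 (size P))); last first.
  by rewrite (leq_trans (size_poly _ _)) ?leq_maxr.
rewrite coef_fps_sum; pose G i := P`_i * (T ^+ i) n.
transitivity (\sum_(i < maxn n.+1 (size P)) G i).
  have cE (c : k) f : (in_alg (fps k) c * f) n = c * f n by rewrite -coef_fpsZ -mulr_algl.
  by apply: eq_bigr => i _; rewrite coef_map; apply: cE.
rewrite -!(big_mkord xpredT G) (big_cat_nat (n := n.+1)) //= ?leq_maxl //.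
rewrite [X in _ + X]big_nat_cond [X in _ + X]big1 ?addr0 // => i /andP[/andP[lt_ni _] _].
by rewrite /G coef_Texp ?mulr0.
Qed.

Lemma fps_comp_trunc f n N : (n <= N)%N -> fps_comp f n = poly_comp_T (fps_trunc N f) n.
Proof.
move=> le_nN; rewrite coef_poly_comp; apply: eq_bigr => i _.
by rewrite coef_fps_trunc // (leq_trans _ le_nN) // -ltnS.
Qed.

Lemma fps_comp_linear : linear fps_comp.
Proof.
move=> c f g; apply/fpsP => n; rewrite coef_fpsD coef_fpsZ /= mulr_sumr -big_split /=.
by apply: eq_bigr => i _; rewrite mulrDl mulrA.
Qed.

(** The coefficient [n] depends only on truncations at degree [n], which are polynomials, and
    evaluation of polynomials at [T] is multiplicative. *)
Lemma fps_comp_monoid_morphism : monoid_morphism fps_comp.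
Proof.
split=> [|f g]; apply/fpsP => n.
  by rewrite /= big_ord_recl big1 /= ?mul1r ?addr0 // => i _; rewrite mul0r.
transitivity ((poly_comp_T (fps_trunc n f) * poly_comp_T (fps_trunc n g)) n); last first.
  have coefM (a b : fps k) : (a * b) n = \sum_(i < n.+1) a i * b (n - i)%N by [].
  rewrite !coefM; apply: eq_bigr => i _.
  by rewrite !(@fps_comp_trunc _ _ n) ?leq_subr // -ltnS.
have -> : poly_comp_T (fps_trunc n f) * poly_comp_T (fps_trunc n g) =
    poly_comp_T (fps_trunc n f * fps_trunc n g).
  by rewrite /poly_comp_T rmorphM /= hornerM.
rewrite coef_poly_comp; apply: eq_bigr => i _; congr (_ * _).
by apply: coef_fps_mul; rewrite -ltnS.
Qed.

Lemma fps_comp_inj : injective fps_comp.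
Proof.
move=> f g fg; apply/fpsP => n; have [m] := ubnP n; elim: m n => // m IHm n le_nm.
have /fpsP/(_ n) := fg; rewrite /= !big_ord_recr /= coef_Texp_diag.
rewrite (eq_bigr (fun i : 'I_n => g i * (T ^+ i) n)) => [/addrI|i _].
  by apply: mulIf; rewrite expf_neq0.
by rewrite IHm // (leq_trans (ltn_ord i)).
Qed.

(** Solves the triangular system for the coefficients of the preimage one at a time; its diagonal
    entries are the powers of [u 0]. *)
Fixpoint fps_comp_inv_seq h n : seq k :=
  if n is m.+1 then
    let s := fps_comp_inv_seq h m in
    rcons s ((h m - \sum_(i < m) s`_i * (T ^+ i) m) / (T ^+ m) m)
  else [::].

Lemma size_fps_comp_inv_seq h n : size (fps_comp_inv_seq h n) = n.
Proof. by elim: n => //= n IHn; rewrite size_rcons IHn. Qed.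

Lemma nth_fps_comp_inv_seq h n i : (i < n)%N ->
  (fps_comp_inv_seq h n)`_i = (fps_comp_inv_seq h i.+1)`_i.
Proof.
elim: n => // n IHn; rewrite ltnS leq_eqVlt => /predU1P[-> // | lt_in].
by rewrite {1}/fps_comp_inv_seq -/fps_comp_inv_seq nth_rcons size_fps_comp_inv_seq lt_in IHn.
Qed.

Definition fps_comp_inv h : fps k := Fps (fun n => (fps_comp_inv_seq h n.+1)`_n).

Lemma fps_comp_invK : cancel fps_comp_inv fps_comp.
Proof.
move=> h; apply/fpsP => n; rewrite [LHS]/= big_ord_recr /=.
rewrite nth_rcons size_fps_comp_inv_seq ltnn eqxx coef_Texp_diag.
rewrite divfK ?expf_neq0 //.
rewrite (eq_bigr (fun i : 'I_n => (fps_comp_inv_seq h n)`_i * (T ^+ i) n)) => [|i _].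
  by rewrite addrC subrK.
by rewrite -/(fps_comp_inv_seq h i.+1) [in RHS]nth_fps_comp_inv_seq.
Qed.

Lemma fps_comp_bij : bijective fps_comp.
Proof.
exists fps_comp_inv; last exact: fps_comp_invK.
by move=> f; apply: fps_comp_inj; rewrite fps_comp_invK.
Qed.

Lemma substitution_aut : exists v : fps_aut k, v (fpsX k) = T.
Proof.
exists (FpsAut fps_comp_linear fps_comp_monoid_morphism fps_comp_bij).
apply/fpsP => n; rewrite [LHS]/= big_ord_recl /= mul0r add0r.
case: n => [|n]; first by rewrite big_ord0 big_ord1 mul0r.
rewrite big_ord_recl big1 => [|i _]; last by rewrite /= mul0r.
by rewrite (_ : bump 0 ord0 = 1%N) // mul1r expr1 addr0.
Qed.

End Substitution.

Lemma rmorph_beta (F : fieldType) (f : {rmorphism F -> F}) (c x y : F) : f c = c ->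
  f ((y + c * x ^+ 2) / x ^+ 3) = (f y + c * f x ^+ 2) / f x ^+ 3.
Proof. by move=> fc; rewrite fmorph_div rmorphD rmorphM !rmorphXn /= fc. Qed.

(** * The dictionary between sigma_b and the curve *)

Section SigmaB.
Variable k : fieldType.
Local Notation K := (laurent k).
Local Notation t := (laurent_t k).
Implicit Types (x y z : K) (s u : fps_aut k) (b : k) (beta : fps k).
Hypothesis pchar2 : 2%N \in [pchar k].

Let h2 : 2%:R = 0 :> K := laurent_pchar2 pchar2.

Lemma to_laurentZ (c : k) (f : fps k) : to_laurent (c *: f) = cst c * to_laurent f.
Proof. by rewrite -mulr_algl rmorphM. Qed.

Lemma cst_curve b : cst b ^+ 2 + cst b + 1 = cst (b ^+ 2 + b + 1).
Proof. by rewrite !rmorphD rmorphXn rmorph1. Qed.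

(** The difference of the equations factors through [z + z' - 1], which has order 0. *)
Lemma artin_schreier_root z z' : vge 1 z -> vge 1 z' ->
  z ^+ 2 - z = z' ^+ 2 - z' -> z = z'.
Proof.
move=> z1 z'1 /eqP; rewrite -subr_eq0.
have -> : z ^+ 2 - z - (z' ^+ 2 - z') = (z - z') * (z + z' - 1) by ring.
rewrite mulf_eq0 subr_eq0 => /orP[/eqP // |/eqP zz'].
have : hval (z + z' - 1) 0.
  by rewrite addrC; apply: hvalD; [apply/hvalN/hval1|apply: vgeD].
by move/hval_neq0; rewrite zz' eqxx.
Qed.

Lemma is_betaP b beta : is_beta b beta <->
  vge 1 (to_laurent beta) /\
  to_laurent beta ^+ 2 - to_laurent beta = t ^+ 3 + cst (b ^+ 2 + b + 1) * t ^+ 2.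
Proof.
split=> [[[c ->] E]|[v1 E]].
  split; first by rewrite rmorphM; exists c; rewrite expr1z.
  have := congr1 (@to_laurent k) E.
  by rewrite rmorphB rmorphXn rmorphD /= to_laurentZ !rmorphXn.
split; last first.
  apply: to_laurent_inj; rewrite rmorphB rmorphXn rmorphD /= to_laurentZ !rmorphXn.
  exact: E.
have [g gE] := fps_split beta; exists g.
by rewrite gE (vge1_fps v1) scale0r add0r.
Qed.

Lemma is_beta_uniq b beta beta' : is_beta b beta -> is_beta b beta' -> beta = beta'.
Proof.
move=> /is_betaP[v1 E] /is_betaP[v1' E']; apply: to_laurent_inj.
by apply: artin_schreier_root => //; rewrite E E'.
Qed.

Lemma is_sigmaP b beta s : is_sigma b beta s <->
  sg s t = (cst b ^+ 2 * t + (cst b + 1) * t ^+ 2 + to_laurent beta)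
           / (cst b ^+ 2 + t ^+ 2).
Proof.
rewrite /is_sigma sg_fps !rmorphD /= !to_laurentZ -/t.
rewrite !(rmorphD (@cst k)) !(rmorphXn (@cst k)) /= rmorph1 !rmorphXn /=.
by rewrite rmorph1 mulr1.
Qed.

Lemma is_sigma_uniq b beta s s' : is_sigma b beta s -> is_sigma b beta s' -> s = s'.
Proof. by move=> /is_sigmaP E /is_sigmaP E'; apply: aut_ext_sg; rewrite E E'. Qed.

(** In characteristic 2 this is the square of [t + cst b]. *)
Lemma sigma_denominator b : cst b ^+ 2 + t ^+ 2 != 0.
Proof.
have -> : cst b ^+ 2 + t ^+ 2 = (t + cst b) ^+ 2 - 2%:R * (t * cst b) by ring.
rewrite h2 mul0r subr0 expf_neq0 //; have [->|b0] := eqVneq b 0.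
  by rewrite rmorph0 addr0 t_neq0.
by rewrite addrC; apply: (hval_neq0 (hvalD (hval_cst b0) (hval_vge (hval_t k)))).
Qed.

Lemma hval_x1 x : hval x (-2) -> x != 0 /\ x + 1 != 0.
Proof.
move=> vx; split; first exact: hval_neq0 vx.
by apply: (hval_neq0 (hvalD vx _)); apply: vge_le (hval_vge (hval1 k)).
Qed.

Lemma model_sigma s b x y : model s b x y -> t = y / x ^+ 2 ->
  exists beta, [/\ is_beta b beta, is_sigma b beta s
                 & to_laurent beta = (y + cst (b ^+ 2 + b + 1) * x ^+ 2) / x ^+ 3].
Proof.
move=> [vx vy eq sx sy] tE; have [x0 x1] := hval_x1 vx.
have vb : vge 1 ((y + cst (b ^+ 2 + b + 1) * x ^+ 2) / x ^+ 3).
  have vx3 := hvalV (hvalX 3 vx).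
  apply: (@vgeM _ (-5) 6); last exact: hval_vge vx3.
  apply: vgeD; first by apply: vge_le (hval_vge vy).
  rewrite mulrC; apply: vgeM0; last exact: vge_cst.
  exact: vge_le (hval_vge (hvalX 2 vx)).
have [beta bE] := vge0P (vge_le (isT : (0 : int) <= 1) vb); exists beta.
split; last exact: esym.
- apply/is_betaP; rewrite -bE; split=> //.
  by rewrite tE; exact: (beta_equation h2 eq x0).
apply/is_sigmaP; rewrite -bE tE fmorph_div rmorphXn /= sx sy -cst_curve.
have eq' : y ^+ 2 + y = x ^+ 3 + (cst b ^+ 2 + cst b + 1) * x ^+ 2.
  by rewrite cst_curve; exact: eq.
apply: (sigma_formula h2 eq' x0 x1).
by rewrite -tE; apply: sigma_denominator.
Qed.

Lemma sigma_model s b beta : is_beta b beta -> is_sigma b beta s ->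
  let x := (to_laurent beta + 1) / t ^+ 2 in model s b x (t * x ^+ 2).
Proof.
move=> /is_betaP[v1 E] /is_sigmaP sE x; set y := t * x ^+ 2.
have vb : hval (to_laurent beta + 1) 0 by rewrite addrC; apply: hvalD; [apply: hval1|].
have b0 := hval_neq0 vb; have t0 := t_neq0 k.
have vx : hval x (-2) by apply: (hvalM vb (hvalV (hvalX 2 (hval_t k)))).
have vy : hval y (-3) by apply: (hvalM (hval_t k) (hvalX 2 vx)).
have [x0 x1] := hval_x1 vx; have y0 := hval_neq0 vy.
have eq : y ^+ 2 + y = x ^+ 3 + cst (b ^+ 2 + b + 1) * x ^+ 2 := curve_of_beta h2 E t0.
have tE : t = y / x ^+ 2 by rewrite /y (mulfK (expf_neq0 2 x0)).
have bE : (y + cst (b ^+ 2 + b + 1) * x ^+ 2) / x ^+ 3 = to_laurent beta :=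
  beta_of_beta h2 E t0 b0.
have eq' : y ^+ 2 + y = x ^+ 3 + (cst b ^+ 2 + cst b + 1) * x ^+ 2.
  by rewrite cst_curve; exact: eq.
have stE : sg s t = (y + x + cst b) / (x + 1) ^+ 2.
  have d0 : cst b ^+ 2 + (y / x ^+ 2) ^+ 2 != 0 by rewrite -tE; apply: sigma_denominator.
  rewrite (sigma_formula h2 eq' x0 x1 d0) cst_curve bE -tE; exact: sE.
have eq1 : (y + x + cst b) ^+ 2 + (y + x + cst b) =
    (x + 1) ^+ 3 + cst (b ^+ 2 + b + 1) * (x + 1) ^+ 2.
  by rewrite -cst_curve; exact: (curve_automorphism h2 eq').
have vx1 : hval (x + 1) (-2).
  by apply: hvalD => //; apply: vge_le (hval_vge (hval1 k)).
have vy1 : hval (y + x + cst b) (-3).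
  rewrite -addrA; apply: hvalD => //; apply: vgeD; first exact: hval_vge.
  by apply: vge_le (vge_cst b).
(* The formula only gives [s t]. The image of [beta] is the root of positive order of the
   Artin-Schreier equation at [s t], and the point [(x + 1, y + x + b)] supplies such a root. *)
have sbE : sg s (to_laurent beta) =
    (y + x + cst b + cst (b ^+ 2 + b + 1) * (x + 1) ^+ 2) / (x + 1) ^+ 3.
  apply: artin_schreier_root.
  - exact: vge_sg.
  - apply: (@vgeM _ (-5) 6); last exact: (hval_vge (hvalV (hvalX 3 vx1))).
    apply: vgeD; first by apply: vge_le (hval_vge vy1).
    rewrite mulrC; apply: vgeM0; last exact: vge_cst.
    exact: vge_le (hval_vge (hvalX 2 vx1)).
  - rewrite (beta_equation h2 eq1 x1) -stE.
    have := congr1 (sg s) E; rewrite rmorphB rmorphXn rmorphD rmorphM !rmorphXn /=.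
    by rewrite sg_cst.
have sx : sg s x = x + 1.
  rewrite /x fmorph_div rmorphD rmorph1 rmorphXn /= sbE stE.
  exact: (x_of_beta h2 eq1 x1 (hval_neq0 vy1)).
have sy : sg s y = y + x + cst b.
  rewrite {1}/y rmorphM rmorphXn /= sx stE; apply: divfK; exact: expf_neq0.
by split.
Qed.

Lemma model_order4 s b x y : model s b x y -> t = y / x ^+ 2 -> (s ^+ 4)%g = 1%g.
Proof.
move=> M tE; apply: aut_ext_sg; rewrite sg1 sgX /=.
have [rx ry] := model_square pchar2 M.
have sst : sg s (sg s t) = (y + 1) / x ^+ 2.
  by rewrite tE !fmorph_div !rmorphXn /= rx ry.
rewrite sst; rewrite tE !fmorph_div !rmorphXn /= rx !rmorphD !rmorph1 /= ry.
by rewrite -addrA laurent_addxx // addr0.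
Qed.

Lemma subgroup_gen4 s u : (s ^+ 4)%g = 1%g -> subgroup_gen s u -> exists i, u = (s ^+ i)%g.
Proof.
move=> s4; apply: (smallest_sub (X := fun u => exists i, u = (s ^+ i)%g)); last first.
  by move=> _ ->; exists 1%N; rewrite expg1.
split=> [|v w]; rewrite !inE /=; first by exists 0%N.
(* The inverse of [s ^+ j] is [s ^+ (3 * j)]. *)
move=> [i ->] [j ->]; exists (i + 3 * j)%N.
rewrite expgnDr; congr (_ * _)%g; apply: (mulgI (s ^+ j)%g).
by rewrite mulgV -expgnDr -mulSn expgnA s4 expg1n.
Qed.

Lemma sigma_almost_rational s b beta m :
  is_beta b beta -> is_sigma b beta s -> has_order s m -> almost_rational 2 s.
Proof.
move=> Hb Hs om; split; first by exists m.
pose B : K := to_laurent beta; pose x : K := (B + 1) / t ^+ 2; pose y : K := t * x ^+ 2.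
have [v1 E] : vge 1 B /\ B ^+ 2 - B = t ^+ 3 + cst (b ^+ 2 + b + 1) * t ^+ 2.
  exact: iffLR (is_betaP b beta) Hb.
have M : model s b x y by exact: sigma_model Hb Hs.
have [vx vy eq sx sy] := M; have [x0 x1] := hval_x1 vx.
have tE : t = y / x ^+ 2 by rewrite /y (mulfK (expf_neq0 2 x0)).
have Mt : adjoin [set t; B]%classic t by apply: adjoin_gen; left.
have MB : adjoin [set t; B]%classic B by apply: adjoin_gen; right.
exists B; split.
- rewrite /wp E; apply: adjoinD; first by apply: adjoinX; apply: adjoin_gen.
  by apply: adjoinM; [apply: adjoin_cst|apply: adjoinX; apply: adjoin_gen].
(* If [B] were in k(t), it would be a polynomial in [t] by integrality; but [P ^+ 2 - P] is constant
   or of even degree, never a cubic. *)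
- move=> tB; pose a := b ^+ 2 + b + 1.
  pose F : {poly {poly k}} := 'X ^+ 2 - ('X + ('X ^+ 3 + a%:P * 'X ^+ 2)%:P).
  have lF : lead_coef F = 1%:P.
    by rewrite /F lead_coefDl ?lead_coefXn // size_polyXn size_polyN size_XaddC.
  have evE : ev t ('X ^+ 3 + a%:P * 'X ^+ 2) = t ^+ 3 + cst a * t ^+ 2.
    by rewrite rmorphD rmorphM !rmorphXn /= evC evX.
  have FB : ev2 t B F = 0.
    have X2 : ev2 t B ('X ^+ 2) = B ^+ 2 by rewrite rmorphXn /= ev2X.
    have X1 G : ev2 t B ('X + G%:P) = B + ev t G by rewrite rmorphD /= ev2X ev2C.
    by rewrite /F ev2B X2 X1 evE -E [B + _]addrC subrK subrr.
  have [P BP] := integral_ratio (@ev_t_eq0 k) (oner_neq0 _) lF tB FB.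
  have PE : P ^+ 2 - P = 'X ^+ 3 + a%:P * 'X ^+ 2.
    apply/eqP; rewrite -subr_eq0 -ev_t_eq0 (rmorphB (ev t)) (rmorphB (ev t)) /= evE.
    by rewrite rmorphXn /= -BP E subrr.
  have s4 : size (P ^+ 2 - P) = 4.
    rewrite PE size_polyDl size_polyXn // mul_polyC.
    by apply: leq_ltn_trans (size_scale_leq _ _) _; rewrite size_polyXn.
  have [sP|sP] := leqP (size P) 1.
    suff : (size (P ^+ 2 - P)%R <= 1)%N by rewrite s4.
    by rewrite (size1_polyC sP) -rmorphXn -rmorphB size_polyC_leq1.
  move: s4; have P0 : P != 0 by rewrite -size_poly_gt0 ltnW.
  have sP2 : size (P ^+ 2) = (size P + size P).-1 by rewrite expr2 size_mul.
  rewrite size_polyDl ?size_polyN sP2; first by move: sP; case: (size P) => // i; lia.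
  by move: sP; case: (size P) => // i; lia.
have Mx : adjoin [set t; B]%classic x.
  by apply: adjoin_div; [apply: adjoinD; [|apply: adjoin1]|apply: adjoinX].
have My : adjoin [set t; B]%classic y by apply: adjoinM => //; apply: adjoinX.
have Ms z : adjoin [set t; B]%classic z -> adjoin [set t; B]%classic (sg s z).
  have BE : B = (y + cst (b ^+ 2 + b + 1) * x ^+ 2) / x ^+ 3.
    have b0 : B + 1 != 0.
      by apply: contraNneq x0 => b0; rewrite /x b0 mul0r.
    symmetry; exact: (beta_of_beta h2 E (t_neq0 k) b0).
  have Mx1 : adjoin [set t; B]%classic (x + 1) by apply: adjoinD => //; apply: adjoin1.
  have My1 : adjoin [set t; B]%classic (y + x + cst b).
    by apply: adjoinD; [apply: adjoinD|apply: adjoin_cst].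
  apply: adjoin_sg => _ [->|->].
    have -> : sg s t = (y + x + cst b) / (x + 1) ^+ 2.
      by rewrite tE fmorph_div rmorphXn /= sx sy.
    by apply: adjoin_div; [exact: My1|exact: adjoinX].
  have -> : sg s B = (y + x + cst b + cst (b ^+ 2 + b + 1) * (x + 1) ^+ 2) / (x + 1) ^+ 3.
    by rewrite -sy -sx [in LHS]BE; exact: (@rmorph_beta K (sg s) _ x y (sg_cst s _)).
  apply: adjoin_div; last exact: adjoinX.
  apply: adjoinD; first exact: My1.
  by apply: adjoinM; [exact: adjoin_cst|exact: adjoinX].
have s4 := model_order4 M tE.
have Gt u : subgroup_gen s u -> adjoin [set t; B]%classic (sg u t).
  move=> /(subgroup_gen4 s4)[i ->]; rewrite sgX.
  by elim: i => // i IHi; apply: Ms.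
apply/seteqP; split=> z.
  by apply: adjoin_sub => _ [u Gu <-]; rewrite -sg_fps; apply: Gt.
have gen u : subgroup_gen s u ->
    adjoin [set to_laurent (u (fpsX k)) | u in subgroup_gen s]%classic (sg u t).
  by move=> Gu; rewrite sg_fps; apply: adjoin_gen; exists u.
have Gt0 := gen _ (@subgroup_genX _ s 0); rewrite expg0 sg1 in Gt0.
have Gs := gen _ (@subgroup_gen_id _ s).
apply: adjoin_sub => _ [->|->] //.
(* The formula of sigma_b is affine in beta, so beta is recovered from [t] and [s t]. *)
have -> : B = sg s t * (cst b ^+ 2 + t ^+ 2) - (cst b ^+ 2 * t + (cst b + 1) * t ^+ 2).
  have /is_sigmaP -> := Hs; rewrite divfK ?sigma_denominator //.
  by rewrite addrC addKr.
have Gc c : adjoin [set to_laurent (u (fpsX k)) | u in subgroup_gen s]%classic (cst c).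
  by apply: adjoin_cst.
have Gb : adjoin [set to_laurent (u (fpsX k)) | u in subgroup_gen s]%classic (cst b + 1).
  by apply: adjoinD => //; apply: adjoin1.
apply: adjoinB.
  by apply: adjoinM => //; apply: adjoinD; apply: adjoinX.
by apply: adjoinD; apply: adjoinM => //; apply: adjoinX.
Qed.

Lemma has_order_conj s v m : has_order s m -> has_order (s ^ v)%g m.
Proof.
move=> [m0 sm sj]; split=> // [|j /sj sj1]; first by rewrite -conjXg sm conj1g.
by rewrite -conjXg => /eqP; rewrite conjg_eq1 => /eqP.
Qed.

Lemma model_uniformizer s b x y : model s b x y ->
  exists v : fps_aut k, sg v t = y / x ^+ 2.
Proof.
move=> [vx vy _ _ _].
have [u u0 uE] : hval (y / x ^+ 2) 1 by apply: (hvalM vy (hvalV (hvalX 2 vx))).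
have [v vX] := substitution_aut u0; exists v.
by rewrite sg_fps vX rmorphM uE expr1z.
Qed.

End SigmaB.

(** * Conjugation into the family sigma_b and comparison of parameters *)

Theorem theorem1p2 (k : fieldType) (p : nat) (charkp : p \in [pchar k])
    (perfk : perfect k p) (sigma : fps_aut k) (n : nat) (n_gt1 : (1 < n)%N)
    (ar_sigma : almost_rational p sigma)
    (ord_sigma : has_order sigma (p ^ n)%N) :
  p = 2%N /\ n = 2%N /\
  exists b : k,
    (exists (beta : fps k) (sigma_b : fps_aut k),
       [/\ unique (is_beta b) beta,
           unique (is_sigma b beta) sigma_b,
           has_order sigma_b 4,
           almost_rational p sigma_b
         & conjugate sigma sigma_b])
    /\
    (forall (b' : k) (beta' : fps k) (sigma_b' : fps_aut k),
       is_beta b' beta' -> is_sigma b' beta' sigma_b' ->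
       conjugate sigma sigma_b' ->
       exists a : k, b' - b = wp p a).
Proof.
have [p2 n2 break] := order_and_break charkp n_gt1 ar_sigma ord_sigma.
rewrite {}p2 {}n2 in charkp ar_sigma ord_sigma *; split=> //; split=> //.
have depth := pow_order_break charkp ord_sigma.
have [_ [beta [wp_beta _ LE]]] := ar_sigma.
have [r rE] : exists r, r = (sigma ^+ 2)%g by exists (sigma ^+ 2)%g.
rewrite -rE in break.
have r_invol : (r ^+ 2 = 1)%g by rewrite rE -expgnA; case: ord_sigma.
have [b [x [y M]]] : exists b x y, model sigma b x y.
  have [w [y [a [b [c [a0 vw vy wyE [Lw Ly LX rw ry]]]]]]] :=
    elliptic_model charkp wp_beta LE rE r_invol break.
  apply: (normal_form charkp (sg_rE rE) depth a0 vw vy wyE LX Lw Ly _ rw ry).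
  by move=> z; apply: (adjoin_orbit_sg wp_beta LE rE break).
exists b; split.
  (* Conjugating by [v] turns the uniformizer [y / x ^+ 2] into [t], where the dictionary yields the
     formula of sigma_b. *)
  have [v vE] := model_uniformizer M; set sb := (sigma ^ v)%g.
  have Mb : model sb b (sg v^-1%g x) (sg v^-1%g y) := model_conj v M.
  have tE : laurent_t k = sg v^-1%g y / sg v^-1%g x ^+ 2.
    by rewrite -[LHS](sgV vE) fmorph_div rmorphXn.
  have [beta_b [Hb Hs _]] := model_sigma charkp Mb tE.
  have ord_b : has_order sb 4 by apply: has_order_conj.
  exists beta_b, sb; split=> //.
  - by split=> // beta' /(is_beta_uniq Hb).
  - by split=> // s' /(is_sigma_uniq Hs).
  - exact: sigma_almost_rational Hb Hs ord_b.
  - by exists v.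
move=> b' beta' sb' Hb' Hs' [v sbE].
(* Undoing the conjugation gives a second model of [sigma] itself, with parameter [b']. *)
have M' := sigma_model charkp Hb' Hs'; rewrite sbE in M'.
have := model_conj v^-1%g M'; rewrite conjgK => M''.
exact: (model_unique charkp (sg_rE rE) depth break M M'').
Qed.
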